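(* Let $\Gamma$ be a countable discrete group. Suppose that $\mathrm{H}_a^2(\Gamma,\mathcal{W})=0$ for the asymptotic ${}^*\Gamma$-module $\mathcal{W}$ associated with every internal asymptotic homomorphism of $\Gamma$ to the family $\mathfrak{U}$. Then $\Gamma$ is uniformly $\mathfrak{U}$-stable with a linear estimate.
   Context: Stability. $\mathfrak{U}$ is the family of metric groups $(U(n),\|\cdot\|)$, $n\in\mathbf{N}$, where $\|\cdot\|$ is a norm on $M_n(\mathbf{C})$ that is submultiplicative ($\|AB\|\le\|A\|\|B\|$) and unitarily bi-invariant ($\|uAv\|=\|A\|$ for $u,v\in U(n)$), with metric $d(u,v)=\|u-v\|$. For a map $\phi:\Gamma\to G$ with $(G,d_G)\in\mathfrak{U}$, its defect is $def(\phi)=\sup_{x,y\in\Gamma}d_G(\phi(xy),\phi(x)\phi(y))$; $\phi$ is an $\epsilon$-homomorphism if $def(\phi)\le\epsilon$; its homomorphism distance is $D(\phi)=\inf_{\psi\in Hom(\Gamma,G)}\sup_{x\in\Gamma}d_G(\phi(x),\psi(x))$. $\Gamma$ is uniformly $\mathfrak{U}$-stable with a linear estimate if there are $\epsilon_0>0$ and $M\ge0$ such that for all $\epsilon<\epsilon_0$ and all $G\in\mathfrak{U}$, every $\epsilon$-homomorphism $\phi:\Gamma\to G$ satisfies $D(\phi)\le M\epsilon$. Ultraproducts. Fix a non-principal ultrafilter $\mathcal{U}$ on $\mathbf{N}$. $\prod_{\mathcal{U}}X_n$ is the algebraic ultraproduct, with elements $\{x_n\}_{\mathcal{U}}$, and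 ${}^*X$ is the ultrapower of $X$. A map between ultraproducts is internal if it is of the form $\{f_n\}_{\mathcal{U}}$ for a sequence of maps $f_n$. ${}^*\mathbf{R}_b\subset{}^*\mathbf{R}$ is the set of hyperreals bounded in absolute value by a standard real, and ${}^*\mathbf{R}_{inf}$ is the set of infinitesimals. The module $\mathcal{W}$. An internal asymptotic homomorphism $\phi=\{\phi_n\}_{\mathcal{U}}$ of $\Gamma$ to $\mathfrak{U}$ is given by $(U(k_n),\|\cdot\|_n)\in\mathfrak{U}$ and maps $\phi_n:\Gamma\to U(k_n)$ with $\{def(\phi_n)\}_{\mathcal{U}}\in{}^*\mathbf{R}_{inf}$. Let $\mathfrak{u}(k)$ be the real vector space of anti-Hermitian $k\times k$ matrices. Set $\mathcal{W}=\prod_{\mathcal{U}}\mathfrak{u}(k_n)$, with the ${}^*\mathbf{R}$-valued norm induced by the $\|\cdot\|_n$ and the internal map $\pi_\Gamma:{}^*\Gamma\times\mathcal{W}\to\mathcal{W}$, $\pi_\Gamma(g)v=\phi(g)v\phi(g)^{-1}$. Let $\mathcal{W}_b$ (resp. $\mathcal{W}_{inf}$) be the elements with norm in ${}^*\mathbf{R}_b$ (resp. ${}^*\mathbf{R}_{inf}$), and $\tilde{\mathcal{W}}=\mathcal{W}_b/\mathcal{W}_{inf}$; $\pi_\Gamma$ induces an action of ${}^*\Gamma$ on $\tilde{\mathcal{W}}$. (Replacing $\phi$ in the formula for $\pi_\Gamma$ by another internal map $\psi$ whose uniform distance to $\phi$ is at most a bounded multiple of $def(\phi)$ does not change the induced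 action.) Asymptotic cohomology. For $m\ge1$ let $\mathcal{L}^\infty(({}^*\Gamma)^m,\mathcal{W})=\prod_{\mathcal{U}}\ell^\infty(\Gamma^m,\mathfrak{u}(k_n))$ with its ${}^*\mathbf{R}$-valued supremum norm; let $\mathcal{L}^\infty_b$ and $\mathcal{L}^\infty_{inf}$ be the elements of bounded, resp. infinitesimal, norm, and $\tilde{\mathcal{L}}^\infty=\mathcal{L}^\infty_b/\mathcal{L}^\infty_{inf}$. The internal map $(g\cdot f)(g_1,\dots,g_m)=\pi_\Gamma(g)f(g^{-1}g_1,\dots,g^{-1}g_m)$ induces an action of ${}^*\Gamma$ on $\tilde{\mathcal{L}}^\infty(({}^*\Gamma)^m,\mathcal{W})$. The maps $d^mf(g_0,\dots,g_m)=\sum_{j=0}^m(-1)^jf(g_0,\dots,\hat{g_j},\dots,g_m)$ induce ${}^*\Gamma$-equivariant maps $\tilde d^m:\tilde{\mathcal{L}}^\infty(({}^*\Gamma)^m,\mathcal{W})\to\tilde{\mathcal{L}}^\infty(({}^*\Gamma)^{m+1},\mathcal{W})$. $\mathrm{H}_a^m(\Gamma,\mathcal{W})$ is the $m$-th cohomology of $$0\to\tilde{\mathcal{L}}^\infty({}^*\Gamma,\mathcal{W})^{{}^*\Gamma}\xrightarrow{\tilde d^1}\tilde{\mathcal{L}}^\infty(({}^*\Gamma)^2,\mathcal{W})^{{}^*\Gamma}\xrightarrow{\tilde d^2}\tilde{\mathcal{L}}^\infty(({}^*\Gamma)^3,\mathcal{W})^{{}^*\Gamma}\to\cdots$$ where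 $\tilde{\mathcal{L}}^\infty(({}^*\Gamma)^{m+1},\mathcal{W})^{{}^*\Gamma}$ is in degree $m$. *)

(* Defs.v *)
From HB Require Import structures.
From mathcomp Require Import all_boot all_order all_algebra.
From mathcomp Require Import spectral complex.
From mathcomp Require Import boolp classical_sets functions cardinality filter.
From mathcomp Require Import reals.

Set Implicit Arguments.
Unset Strict Implicit.
Unset Printing Implicit Defensive.

Import Order.TTheory GRing.Theory Num.Theory.
Local Open Scope quotient_scope.
Local Open Scope classical_set_scope.
Local Open Scope complex_scope.
Local Open Scope ring_scope.
Local Open Scope sesquilinear_scope.

Section UnitaryGroup.
Variables (R : realType) (n : nat).
Implicit Types A B : 'M[R[i]]_n.

Record unitary := Unitary { unitary_mx :> 'M[R[i]]_n;
                            unitary_mxP : unitary_mx \is unitarymx }.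
HB.instance Definition _ := [isSub for unitary_mx].
HB.instance Definition _ := [Choice of unitary by <:].

Lemma unitary1_subproof : (1%:M : 'M[R[i]]_n) \is unitarymx.
Proof. by apply/unitarymxP; rewrite mul1mx trmx1 map_mx1. Qed.

Lemma unitaryV_subproof (u : unitary) : (u : 'M_n)^t* \is unitarymx.
Proof. by rewrite trmxC_unitary unitary_mxP. Qed.

Definition unitary_one := Unitary unitary1_subproof.
Definition unitary_inv u := Unitary (unitaryV_subproof u).
Definition unitary_mul (u v : unitary) :=
  Unitary (mul_unitarymx (unitary_mxP u) (unitary_mxP v)).

Lemma unitary_mulA : associative unitary_mul.
Proof. by move=> u v w; apply/val_inj; rewrite /= mulmxA. Qed.
Lemma unitary_mul1g : left_id unitary_one unitary_mul.
Proof. by move=> u; apply/val_inj; rewrite /= mul1mx. Qed.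
Lemma unitary_mulg1 : right_id unitary_one unitary_mul.
Proof. by move=> u; apply/val_inj; rewrite /= mulmx1. Qed.
Lemma unitary_mulgV : right_inverse unitary_one unitary_inv unitary_mul.
Proof. by move=> u; apply/val_inj/unitarymxP/unitary_mxP. Qed.
Lemma unitary_mulVg : left_inverse unitary_one unitary_inv unitary_mul.
Proof. by move=> u; apply/val_inj/mulmx1C/unitarymxP/unitary_mxP. Qed.

HB.instance Definition _ := isGroup.Build unitary unitary_mulA unitary_mul1g
  unitary_mulg1 unitary_mulVg unitary_mulgV.

(* Nonnegativity and unorm 0 = 0 follow from unormD and unormZ. *)
Record unitary_norm := UnitaryNorm {
  unorm :> 'M[R[i]]_n -> R;
  unormD : forall A B, unorm (A + B) <= unorm A + unorm B;
  unormZ : forall (a : R[i]) A, unorm (a *: A) = complex.Re `|a| * unorm A;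
  unorm0_eq0 : forall A, unorm A = 0 -> A = 0;
  unormM : forall A B, unorm (A *m B) <= unorm A * unorm B;
  unorm_biinv : forall (u v : unitary) A, unorm (u *m A *m v) = unorm A
}.

Definition antihermmx : {pred 'M[R[i]]_n} := [pred A | A^t* == - A].

Lemma antihermmx_zmod_closed : zmod_closed antihermmx.
Proof.
split=> [|A B]; first by rewrite inE trmx0 map_mx0 oppr0.
by rewrite !inE linearB map_mxB => /eqP -> /eqP ->; rewrite opprB opprK addrC.
Qed.
HB.instance Definition _ :=
  GRing.isZmodClosed.Build _ antihermmx antihermmx_zmod_closed.

Record antiherm := AntiHerm { antiherm_mx :> 'M[R[i]]_n;
                              antiherm_mxP : antiherm_mx \in antihermmx }.
HB.instance Definition _ := [isSub for antiherm_mx].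
HB.instance Definition _ := [Choice of antiherm by <:].
HB.instance Definition _ := [SubChoice_isSubZmodule of antiherm by <:].

Lemma antiherm_conj_subproof (u : unitary) (v : antiherm) :
  (u *m v *m (u^-1)%g) \in antihermmx.
Proof.
have /eqP vE := antiherm_mxP v; rewrite inE /=.
rewrite !trmx_mul !map_mxM [X in X *m _](_ : _ = u :> 'M_n) ?trmxCK //.
by rewrite vE mulNmx mulmxN mulmxA.
Qed.
Definition antiherm_conj u v := AntiHerm (antiherm_conj_subproof u v).

End UnitaryGroup.

(* The family of metric groups; dimension 0 (the trivial group) is allowed. *)
Record ufamily (R : realType) := UFamily {
  udim : nat;
  unrm : unitary_norm R udim
}.

Section Stability.
Variables (R : realType) (Gamma : groupType).

Definition udist (G : ufamily R) (u v : unitary R (udim G)) : R :=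
  unrm G (unitary_mx u - unitary_mx v).

Section Defect.
Variables (G : ufamily R) (phi : Gamma -> unitary R (udim G)).

(* All the sets of reals below are nonempty, and bounded because
   udist u v <= 2 * unrm G 1, so that sup and inf are genuine. *)
Definition defect : R :=
  sup (range (fun p : Gamma * Gamma =>
    udist (phi (p.1 * p.2)%g) (phi p.1 * phi p.2)%g)).

Definition eps_hom (eps : R) : Prop := defect <= eps.

Definition hom_dist : R :=
  inf [set sup (range (fun x => udist (phi x) (psi x)))
      | psi in [set: {multiplicative Gamma -> unitary R (udim G)}]].

End Defect.

Definition uniformly_stable_linear : Prop :=
  exists eps0 M : R, [/\ 0 < eps0, 0 <= M &
    forall eps, eps < eps0 ->
    forall (G : ufamily R) (phi : Gamma -> unitary R (udim G)),
      eps_hom phi eps -> hom_dist phi <= M * eps].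

End Stability.

Record free_ultrafilter := FreeUltrafilter {
  ultra_sets :> (nat -> Prop) -> Prop;
  ultra_setsP : UltraFilter ultra_sets;
  ultra_free : forall n, ultra_sets <> principal_filter n
}.
#[global] Existing Instance ultra_setsP.

Section Ultraproduct.
Variable (U : free_ultrafilter).

Section Def.
Variable X : nat -> Type.

Definition ultra_rel (x y : {classic forall n, X n}) : bool :=
  `[< U [set n | x n = y n] >].

Lemma ultra_rel_equiv : equiv_class_of ultra_rel.
Proof.
split=> [x|x y|y x z].
- by apply/asboolP; apply: filterE.
- by apply: asbool_equiv_eq; split; apply: filterS => n /= ->.
- move=> /asboolP xy /asboolP yz; apply/asboolP.
  by apply: filterS2 xy yz => n /= -> ->.
Qed.
Canonical ultra_equiv := EquivRelPack ultra_rel_equiv.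

Definition ultraprod := {eq_quot ultra_equiv}.
HB.instance Definition _ := Choice.on ultraprod.
HB.instance Definition _ := EqQuotient.on ultraprod.

Definition uclass (x : forall n, X n) : ultraprod :=
  \pi_ultraprod (x : {classic forall n, X n}).
Definition urepr (x : ultraprod) : forall n, X n := repr x.

Lemma ureprK x : uclass (urepr x) = x. Proof. exact: reprK. Qed.

Lemma uclass_eq x y : uclass x = uclass y <-> U [set n | x n = y n].
Proof. by split=> [/eqquotP/asboolP|xy]; last exact/eqquotP/asboolP. Qed.

Lemma urepr_uclass x : U [set n | urepr (uclass x) n = x n].
Proof. by apply/uclass_eq; rewrite ureprK. Qed.

End Def.

Section Lift.
Variables X Y Z : nat -> Type.

Definition ulift1 (f : forall n, X n -> Y n) (x : ultraprod X) : ultraprod Y :=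
  uclass (fun n => f n (urepr x n)).
Definition ulift2 (f : forall n, X n -> Y n -> Z n)
    (x : ultraprod X) (y : ultraprod Y) : ultraprod Z :=
  uclass (fun n => f n (urepr x n) (urepr y n)).

Lemma ulift1E f x : ulift1 f (uclass x) = uclass (fun n => f n (x n)).
Proof. by apply/uclass_eq; apply: filterS (urepr_uclass x) => n /= ->. Qed.

Lemma ulift2E f x y :
  ulift2 f (uclass x) (uclass y) = uclass (fun n => f n (x n) (y n)).
Proof.
apply/uclass_eq.
by apply: filterS2 (urepr_uclass x) (urepr_uclass y) => n /= -> ->.
Qed.

End Lift.

Section Zmod.
Variable X : nat -> zmodType.
Let V := ultraprod (fun n => X n).

Definition ultra_zero : V := uclass (fun n => 0 : X n).
Definition ultra_opp : V -> V := ulift1 (fun n (x : X n) => - x).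
Definition ultra_add : V -> V -> V := ulift2 (fun n (x y : X n) => x + y).

Lemma ultra_addA : associative ultra_add.
Proof.
move=> x y z; rewrite -[x]ureprK -[y]ureprK -[z]ureprK /ultra_add !ulift2E.
by apply/uclass_eq; apply: filterE => n; exact: addrA.
Qed.
Lemma ultra_addC : commutative ultra_add.
Proof.
move=> x y; rewrite -[x]ureprK -[y]ureprK /ultra_add !ulift2E.
by apply/uclass_eq; apply: filterE => n; exact: addrC.
Qed.
Lemma ultra_add0 : left_id ultra_zero ultra_add.
Proof.
move=> x; rewrite -[x]ureprK /ultra_add !ulift2E.
by apply/uclass_eq; apply: filterE => n; exact: add0r.
Qed.
Lemma ultra_addN : left_inverse ultra_zero ultra_opp ultra_add.
Proof.
move=> x; rewrite -[x]ureprK /ultra_add /ultra_opp ulift1E !ulift2E.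
by apply/uclass_eq; apply: filterE => n; exact: addNr.
Qed.
HB.instance Definition _ := GRing.isZmodule.Build (ultraprod (fun n => X n))
  ultra_addA ultra_addC ultra_add0 ultra_addN.

Lemma uclass0 : 0 = uclass (fun n => 0 : X n) :> V. Proof. by []. Qed.
Lemma uclassN (x : forall n, X n) : - (uclass x : V) = uclass (fun n => - x n).
Proof. exact: ulift1E. Qed.
Lemma uclassD (x y : forall n, X n) :
  (uclass x : V) + uclass y = uclass (fun n => x n + y n).
Proof. exact: ulift2E. Qed.
Lemma uclassB (x y : forall n, X n) :
  (uclass x : V) - uclass y = uclass (fun n => x n - y n).
Proof. by rewrite uclassN uclassD. Qed.

End Zmod.

Variable R : realType.

Definition hyperreal := ultraprod (fun=> R).
Definition std (r : R) : hyperreal := uclass (fun=> r).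
Definition hyper_le (x y : hyperreal) : Prop :=
  U [set n | urepr x n <= urepr y n].
Definition hyper_abs : hyperreal -> hyperreal :=
  ulift1 (fun _ (r : R) => `|r|).

Definition hyper_bounded (x : hyperreal) : Prop :=
  exists r : R, hyper_le (hyper_abs x) (std r).
Definition infinitesimal (x : hyperreal) : Prop :=
  forall e : R, 0 < e -> hyper_le (hyper_abs x) (std e).

Lemma hyper_leE (x y : nat -> R) :
  hyper_le (uclass x) (uclass y) <-> U [set n | x n <= y n].
Proof.
have xE := urepr_uclass x; have yE := urepr_uclass y.
by split; apply: filterS3 xE yE => n /= -> ->.
Qed.

Lemma hyper_boundedE (x : nat -> R) :
  hyper_bounded (uclass x) <-> exists r, U [set n | `|x n| <= r].
Proof.
by split=> -[r xr]; exists r; move: xr; rewrite /hyper_abs ulift1E hyper_leE.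
Qed.

Lemma infinitesimalE (x : nat -> R) :
  infinitesimal (uclass x) <-> forall e, 0 < e -> U [set n | `|x n| <= e].
Proof.
by split=> xe e /xe; rewrite /hyper_abs ulift1E hyper_leE.
Qed.

End Ultraproduct.

Section NormTheory.
Variables (R : realType) (n : nat) (N : unitary_norm R n).

Lemma unormN A : N (- A) = N A.
Proof. by rewrite -scaleN1r unormZ normrN1 mul1r. Qed.
Lemma unorm0 : N 0 = 0.
Proof. by rewrite -(scale0r (0 : 'M_n)) unormZ normr0 mul0r. Qed.
Lemma unorm_ge0 A : 0 <= N A.
Proof.
have := unormD N A (- A); rewrite subrr unorm0 unormN.
by rewrite -mulr2n pmulrn_lge0.
Qed.
Lemma unormB A B : N (A - B) <= N A + N B.
Proof. by rewrite -(unormN B); exact: unormD. Qed.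
Lemma unorm_conj u v : N (antiherm_conj u v) = N v.
Proof. exact: unorm_biinv. Qed.

End NormTheory.

Section EllInfinity.
Variables (R : realType) (Gamma : groupType) (G : ufamily R).
Let u := antiherm R (udim G).
Let N := unrm G.

Section Space.
Variable m : nat.

Definition linf_pred : {pred ('I_m -> Gamma) -> u} :=
  fun f => `[< exists r, forall x, N (f x) <= r >].

Lemma linf_zmod_closed : zmod_closed linf_pred.
Proof.
split=> [|f g /asboolP[r fr] /asboolP[s gs]]; apply/asboolP.
  by exists 0 => x /=; rewrite unorm0.
exists (r + s) => x; apply: le_trans (unormB _ _ _) _.
exact: lerD (fr x) (gs x).
Qed.
HB.instance Definition _ :=
  GRing.isZmodClosed.Build _ linf_pred linf_zmod_closed.

Record linf := Linf { linf_fun :> ('I_m -> Gamma) -> u;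
                      linf_funP : linf_fun \in linf_pred }.
HB.instance Definition _ := [isSub for linf_fun].
HB.instance Definition _ := [Choice of linf by <:].
HB.instance Definition _ := [SubChoice_isSubZmodule of linf by <:].

Definition sup_norm (f : linf) : R := sup (range (fun x => N (f x))).

Lemma linf_bounded (f : linf) : exists r, forall x, N (f x) <= r.
Proof. exact/asboolP/linf_funP. Qed.

Lemma sup_norm_ub (f : linf) x : N (f x) <= sup_norm f.
Proof.
have [r fr] := linf_bounded f; apply: ub_le_sup; last by exists x.
by exists r => _ [y _ <-].
Qed.

Lemma sup_norm_le (f : linf) r : (forall x, N (f x) <= r) -> sup_norm f <= r.
Proof.
move=> fr; apply: ge_sup; last by move=> _ [y _ <-].
by exists (N (f (fun=> 1%g))), (fun=> 1%g).
Qed.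

Lemma sup_norm_ge0 (f : linf) : 0 <= sup_norm f.
Proof. exact: le_trans (unorm_ge0 _ _) (sup_norm_ub f (fun=> 1%g)). Qed.

Lemma sup_norm0 : sup_norm 0 = 0.
Proof.
apply/le_anti; rewrite sup_norm_ge0 andbT.
by apply: sup_norm_le => x /=; rewrite unorm0.
Qed.

Lemma sup_normB (f g : linf) : sup_norm (f - g) <= sup_norm f + sup_norm g.
Proof.
apply: sup_norm_le => x; apply: (le_trans (unormB N (f x) (g x))).
exact: lerD (sup_norm_ub f x) (sup_norm_ub g x).
Qed.

Section Act.
Variables (phi : Gamma -> unitary R (udim G)) (g : Gamma).

Definition act_fun (f : linf) (x : 'I_m -> Gamma) : u :=
  antiherm_conj (phi g) (f (fun i => g^-1 * x i)%g).

Lemma act_fun_subproof f : act_fun f \in linf_pred.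
Proof.
by apply/asboolP; exists (sup_norm f) => x; rewrite unorm_conj sup_norm_ub.
Qed.
Definition linf_act f := Linf (act_fun_subproof f).

Lemma linf_actB : {morph linf_act : f h / f - h}.
Proof.
move=> f h; apply/val_inj/funext => x; apply/val_inj => /=.
by rewrite mulmxBr mulmxBl.
Qed.

Lemma sup_norm_act f : sup_norm (linf_act f) <= sup_norm f.
Proof. by apply: sup_norm_le => x; rewrite unorm_conj sup_norm_ub. Qed.

End Act.

End Space.

Section Differential.
Variable m : nat.

Definition diff_fun (f : linf m) (x : 'I_m.+1 -> Gamma) : u :=
  \sum_(j < m.+1) f (fun i => x (lift j i)) *~ (-1) ^+ j.

Lemma diff_fun_le f x : N (diff_fun f x) <= sup_norm f *+ m.+1.
Proof.
rewrite -[X in _ *+ X]card_ord -sumr_const /diff_fun.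
elim/big_ind2: _ => [|a b c d ab cd|j _]; first by rewrite unorm0.
  exact: le_trans (unormD _ _ _) (lerD ab cd).
rewrite -signr_odd; case: odd; last exact: sup_norm_ub.
by rewrite expr1 mulrN1z unormN sup_norm_ub.
Qed.

Lemma diff_fun_subproof f : diff_fun f \in @linf_pred m.+1.
Proof. by apply/asboolP; eexists=> x; exact: diff_fun_le. Qed.
Definition linf_diff f := Linf (diff_fun_subproof f).

Lemma linf_diffB : {morph linf_diff : f h / f - h}.
Proof.
move=> f h; apply/val_inj/funext => x /=; rewrite /diff_fun.
rewrite [RHS](_ : _ = diff_fun f x - diff_fun h x) // /diff_fun -sumrB.
by apply: eq_bigr => j _; rewrite -mulrzBl.
Qed.

Lemma sup_norm_diff f : sup_norm (linf_diff f) <= sup_norm f *+ m.+1.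
Proof. by apply: sup_norm_le => x; exact: diff_fun_le. Qed.

End Differential.

Lemma antiherm_conjB w : {morph antiherm_conj w : a b / a - b : u}.
Proof. by move=> a b; apply/val_inj; rewrite /= mulmxBr mulmxBl. Qed.

Lemma linf_diff_act phi g m (f : linf m) :
  linf_diff (linf_act phi g f) = linf_act phi g (linf_diff f).
Proof.
pose conjg_zmod : {additive u -> u} :=
  HB.pack (antiherm_conj (phi g))
    (GRing.isZmodMorphism.Build _ _ _ (antiherm_conjB (phi g))).
apply/val_inj/funext => x; rewrite /= /diff_fun /act_fun /= /diff_fun.
rewrite -[RHS]/(conjg_zmod _) raddf_sum.
by apply: eq_bigr => j _; rewrite raddfMz.
Qed.

End EllInfinity.

Section AsymptoticCohomology.
Variables (R : realType) (Gamma : groupType) (U : free_ultrafilter).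

Record asym_hom := AsymHom {
  asym_fam : nat -> ufamily R;
  asym_map : forall n, Gamma -> unitary R (udim (asym_fam n));
  asym_defect : infinitesimal (uclass U (fun n => defect (asym_map n)))
}.

Variable phi : asym_hom.
Let fam := asym_fam phi.

Definition ustar := ultraprod U (fun=> Gamma).

Section Spaces.
Variable m : nat.

Definition Linf_int := ultraprod U (fun n => linf Gamma (fam n) m).
HB.instance Definition _ := GRing.Zmodule.on Linf_int.

Definition Linf_norm : Linf_int -> hyperreal U R :=
  ulift1 (fun n (f : linf Gamma (fam n) m) => sup_norm f).

Definition Linf_bounded : {pred Linf_int} :=
  fun f => `[< hyper_bounded (Linf_norm f) >].

Lemma Linf_boundedE (f : forall n, linf Gamma (fam n) m) :
  uclass U f \in Linf_bounded <-> exists r, U [set n | sup_norm (f n) <= r].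
Proof.
split=> [/asboolP|[r fr]]; first rewrite /Linf_norm ulift1E hyper_boundedE.
  by case=> r fr; exists r; apply: filterS fr => n /=; exact/le_trans/ler_norm.
apply/asboolP; rewrite /Linf_norm ulift1E hyper_boundedE; exists r.
by apply: filterS fr => n /=; rewrite ger0_norm ?sup_norm_ge0.
Qed.

Lemma Linf_bounded_zmod_closed : zmod_closed Linf_bounded.
Proof.
split=> [|f g].
  by apply/Linf_boundedE; exists 0; apply: filterE => n /=; rewrite sup_norm0.
rewrite -[f]ureprK -[g]ureprK => /Linf_boundedE[r fr] /Linf_boundedE[s gs].
rewrite uclassB; apply/Linf_boundedE; exists (r + s).
apply: filterS2 fr gs => n /= fr gs.
by apply: le_trans (sup_normB _ _) _; rewrite lerD.
Qed.
HB.instance Definition _ :=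
  GRing.isZmodClosed.Build _ Linf_bounded Linf_bounded_zmod_closed.

Record Linf_b := LinfB { Linf_b_val :> Linf_int;
                         Linf_b_valP : Linf_b_val \in Linf_bounded }.
HB.instance Definition _ := [isSub for Linf_b_val].
HB.instance Definition _ := [Choice of Linf_b by <:].
HB.instance Definition _ := [SubChoice_isSubZmodule of Linf_b by <:].

Definition Linf_inf : {pred Linf_b} :=
  fun f => `[< infinitesimal (Linf_norm f) >].

Lemma Linf_infE (f : Linf_b) : f \in Linf_inf <->
  forall e, 0 < e -> U [set n | sup_norm (urepr (f : Linf_int) n) <= e].
Proof.
have E : Linf_norm f = uclass U (fun n => sup_norm (urepr (f : Linf_int) n)).
  by [].
split=> [/asboolP|fe].
  rewrite E infinitesimalE => fe e /fe.
  by apply: filterS => n /=; exact/le_trans/ler_norm.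
apply/asboolP; rewrite E infinitesimalE => e /fe.
by apply: filterS => n /=; rewrite ger0_norm ?sup_norm_ge0.
Qed.

Lemma Linf_inf_zmod_closed : zmod_closed Linf_inf.
Proof.
split=> [|f g /Linf_infE fe /Linf_infE ge]; apply/Linf_infE => e e0.
  have := urepr_uclass U (fun n => 0 : linf Gamma (fam n) m).
  by apply: filterS => n /= ->; rewrite sup_norm0 ltW.
have e20 : 0 < e / 2 by rewrite divr_gt0.
have fgE : U [set n | urepr (Linf_b_val (f - g)) n =
    urepr (f : Linf_int) n - urepr (g : Linf_int) n].
  by rewrite -uclass_eq ureprK -uclassB !ureprK.
apply: filterS3 fgE (fe _ e20) (ge _ e20) => n /= -> fn gn.
by rewrite [e]splitr; apply: le_trans (sup_normB _ _) (lerD fn gn).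
Qed.
HB.instance Definition _ :=
  GRing.isZmodClosed.Build _ Linf_inf Linf_inf_zmod_closed.

Definition tLinf := Quotient.quot Linf_inf.
HB.instance Definition _ := GRing.Zmodule.on tLinf.

End Spaces.

Section Action.
Variables (m : nat) (g : ustar).

Definition Linf_act : Linf_int m -> Linf_int m :=
  ulift2 (fun n (h : Gamma) (f : linf Gamma (fam n) m) =>
    linf_act (@asym_map phi n) h f) g.

Lemma Linf_act_norm f : U [set n |
  sup_norm (urepr (Linf_act f) n) <= sup_norm (urepr f n)].
Proof.
have := urepr_uclass U (fun n =>
  linf_act (@asym_map phi n) (urepr g n) (urepr f n)).
by apply: filterS => n /= ->; exact: sup_norm_act.
Qed.

Lemma Linf_actB : {morph Linf_act : f h / f - h}.
Proof.
move=> f h; rewrite -[f]ureprK -[h]ureprK uclassB /Linf_act -[g]ureprK.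
rewrite !ulift2E uclassB; apply/uclass_eq; apply: filterE => n.
exact: linf_actB.
Qed.

Lemma Linf_act_subproof (f : Linf_b m) : Linf_act f \in @Linf_bounded m.
Proof.
have := Linf_b_valP f; rewrite -[X in X \in _]ureprK -[X in _ -> X \in _]ureprK.
move=> /Linf_boundedE[r fr]; apply/Linf_boundedE; exists r.
by apply: filterS2 (Linf_act_norm f) fr => n /=; exact: le_trans.
Qed.
Definition Linf_b_act (f : Linf_b m) : Linf_b m := LinfB (Linf_act_subproof f).

Lemma Linf_b_actB : {morph Linf_b_act : f h / f - h}.
Proof. by move=> f h; apply/val_inj; exact: Linf_actB. Qed.

Lemma Linf_b_act_inf f : f \in @Linf_inf m -> Linf_b_act f \in @Linf_inf m.
Proof.
move=> /Linf_infE fe; apply/Linf_infE => e /fe.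
by apply: filterS2 (Linf_act_norm f) => n /=; exact: le_trans.
Qed.

(* The choice of representative is irrelevant, see tactE; likewise for tdiff. *)
Definition tact (x : tLinf m) : tLinf m := \pi_(tLinf m) (Linf_b_act (repr x)).

Lemma tactE f : tact (\pi_(tLinf m) f) = \pi_(tLinf m) (Linf_b_act f).
Proof.
apply/eqP; rewrite -Quotient.idealrBE -Linf_b_actB; apply: Linf_b_act_inf.
by rewrite Quotient.idealrBE reprK.
Qed.

Lemma tactB : zmod_morphism tact.
Proof.
move=> x y; rewrite -[x]reprK -[y]reprK -raddfB !tactE Linf_b_actB.
exact: raddfB.
Qed.

End Action.

Section Diff.
Variable m : nat.

Definition Linf_diff : Linf_int m -> Linf_int m.+1 :=
  ulift1 (fun n (f : linf Gamma (fam n) m) => linf_diff f).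

Lemma Linf_diff_norm f : U [set n |
  sup_norm (urepr (Linf_diff f) n) <= sup_norm (urepr f n) *+ m.+1].
Proof.
have := urepr_uclass U (fun n => linf_diff (urepr f n)).
by apply: filterS => n /= ->; exact: sup_norm_diff.
Qed.

Lemma Linf_diffB : {morph Linf_diff : f h / f - h}.
Proof.
move=> f h; rewrite -[f]ureprK -[h]ureprK uclassB /Linf_diff.
rewrite !ulift1E uclassB; apply/uclass_eq; apply: filterE => n.
exact: linf_diffB.
Qed.

Lemma Linf_diff_subproof (f : Linf_b m) : Linf_diff f \in @Linf_bounded m.+1.
Proof.
have := Linf_b_valP f; rewrite -[X in X \in _]ureprK -[X in _ -> X \in _]ureprK.
move=> /Linf_boundedE[r fr]; apply/Linf_boundedE; exists (r *+ m.+1).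
apply: filterS2 (Linf_diff_norm f) fr => n /= df fr.
by apply: le_trans df _; rewrite lerMn2r fr orbT.
Qed.
Definition Linf_b_diff (f : Linf_b m) : Linf_b m.+1 :=
  LinfB (Linf_diff_subproof f).

Lemma Linf_b_diffB : {morph Linf_b_diff : f h / f - h}.
Proof. by move=> f h; apply/val_inj; exact: Linf_diffB. Qed.

Lemma Linf_b_diff_inf f : f \in @Linf_inf m -> Linf_b_diff f \in @Linf_inf m.+1.
Proof.
move=> /Linf_infE fe; apply/Linf_infE => e e0.
have /fe : 0 < e / m.+1%:R by rewrite divr_gt0 ?ltr0n.
apply: filterS2 (Linf_diff_norm f) => n /= df fr; apply: le_trans df _.
by rewrite -mulr_natr -ler_pdivlMr ?ltr0n.
Qed.

Definition tdiff (x : tLinf m) : tLinf m.+1 :=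
  \pi_(tLinf m.+1) (Linf_b_diff (repr x)).

Lemma tdiffE f : tdiff (\pi_(tLinf m) f) = \pi_(tLinf m.+1) (Linf_b_diff f).
Proof.
apply/eqP; rewrite -Quotient.idealrBE -Linf_b_diffB; apply: Linf_b_diff_inf.
by rewrite Quotient.idealrBE reprK.
Qed.

Lemma tdiffB : zmod_morphism tdiff.
Proof.
move=> x y; rewrite -[x]reprK -[y]reprK -raddfB !tdiffE Linf_b_diffB.
exact: raddfB.
Qed.

Lemma tdiff_act g x : tdiff (tact g x) = tact g (tdiff x).
Proof.
rewrite -[x]reprK !(tactE, tdiffE); congr (\pi _); apply/val_inj => /=.
rewrite -[Linf_b_val _]ureprK -[g]ureprK /Linf_act /Linf_diff.
rewrite !(ulift1E, ulift2E); apply/uclass_eq; apply: filterE => n.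
exact: linf_diff_act.
Qed.

End Diff.

Section Cochains.
Variable m : nat.

Definition tLinf_fixed : {pred tLinf m.+1} :=
  fun x => `[< forall g, tact g x = x >].

Lemma tLinf_fixed_zmod_closed : zmod_closed tLinf_fixed.
Proof.
split=> [|x y /asboolP xg /asboolP yg]; apply/asboolP => g.
  by have := @tactB m.+1 g 0 0; rewrite !subrr.
by rewrite tactB xg yg.
Qed.
HB.instance Definition _ :=
  GRing.isZmodClosed.Build _ tLinf_fixed tLinf_fixed_zmod_closed.

(* Degree m consists of functions of m.+1 variables. *)
Record cochain := Cochain { cochain_val :> tLinf m.+1;
                            cochain_valP : cochain_val \in tLinf_fixed }.
HB.instance Definition _ := [isSub for cochain_val].
HB.instance Definition _ := [Choice of cochain by <:].
HB.instance Definition _ := [SubChoice_isSubZmodule of cochain by <:].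

End Cochains.

Lemma coboundary_subproof m (c : cochain m) : tdiff c \in @tLinf_fixed m.+1.
Proof.
by apply/asboolP => g; rewrite -tdiff_act; case: c => c /asboolP /= ->.
Qed.
Definition coboundary m (c : cochain m) : cochain m.+1 :=
  Cochain (coboundary_subproof c).

Lemma coboundaryB m : zmod_morphism (@coboundary m).
Proof. by move=> x y; apply/val_inj; exact: tdiffB. Qed.
HB.instance Definition _ m :=
  GRing.isZmodMorphism.Build _ _ (@coboundary m) (@coboundaryB m).

Definition is_cocycle m : {pred cochain m} := fun c => coboundary c == 0.

Lemma is_cocycle_zmod_closed m : zmod_closed (@is_cocycle m).
Proof.
split=> [|x y /eqP xz /eqP yz]; apply/eqP; first exact: raddf0.
by rewrite coboundaryB xz yz subrr.
Qed.
HB.instance Definition _ m :=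
  GRing.isZmodClosed.Build _ (@is_cocycle m) (@is_cocycle_zmod_closed m).

Record cocycle m := Cocycle { cocycle_val :> cochain m;
                              cocycle_valP : cocycle_val \in @is_cocycle m }.
HB.instance Definition _ m := [isSub for @cocycle_val m].
HB.instance Definition _ m := [Choice of cocycle m by <:].
HB.instance Definition _ m := [SubChoice_isSubZmodule of cocycle m by <:].

(* The complex starts with 0 -> cochain 0, so the only coboundary in degree 0
   is 0. *)
Definition is_coboundary m : {pred cocycle m} :=
  match m with
  | 0 => fun c => c == 0
  | p.+1 => fun c => `[< exists b : cochain p, coboundary b = c >]
  end.

Lemma is_coboundary_zmod_closed m : zmod_closed (@is_coboundary m).
Proof.
case: m => [|m]; split.
- exact: eqxx.
- by move=> x y /eqP -> /eqP ->; rewrite subrr; exact: eqxx.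
- by apply/asboolP; exists 0; rewrite [LHS]raddf0.
- move=> x y /asboolP[b bx] /asboolP[c cy]; apply/asboolP.
  by exists (b - c); rewrite coboundaryB bx cy.
Qed.
HB.instance Definition _ m :=
  GRing.isZmodClosed.Build _ (@is_coboundary m) (@is_coboundary_zmod_closed m).

Definition asym_cohomology m := Quotient.quot (@is_coboundary m).
HB.instance Definition _ m := GRing.Zmodule.on (asym_cohomology m).

End AsymptoticCohomology.

(* Main.v *)
Require Import Defs.
From HB Require Import structures.
From mathcomp Require Import all_boot all_order all_algebra.
From mathcomp Require Import spectral complex ring lra.
From mathcomp Require Import boolp classical_sets functions cardinality filter.
From mathcomp Require Import reals.

Set Implicit Arguments.
Unset Strict Implicit.
Unset Printing Implicit Defensive.

Import Order.TTheory GRing.Theory Num.Theory.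
Local Open Scope quotient_scope.
Local Open Scope classical_set_scope.
Local Open Scope complex_scope.
Local Open Scope ring_scope.
Local Open Scope sesquilinear_scope.

(** The proof is a Newton iteration whose single step is a cohomological
equation. Let [phi] be an [eps]-homomorphism into a unitary group. Its
multiplicative error [phi x phi y (phi (x y))^-1] is [1 + eps * alpha (x, y)] up
to [O(eps^2)], with [alpha] bounded and anti-Hermitian, and comparing the two
ways of bracketing [phi x phi y phi z] shows that [alpha] is a 2-cocycle up to
[O(eps)] for the conjugation action through [phi]. If [alpha] is up to [o(1)] the
coboundary of a bounded [beta], then [psi x = (1 - eps * beta x) phi x], made
unitary by a Cayley transform, lies within [O(eps)] of [phi] and has defect
[o(eps)]: this is [correct_defect].

The existence of [beta], with constants that do not depend on [phi], comes from
the vanishing of asymptotic cohomology. If no constants worked, there would be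
maps [phi_n] with errors [eps_n <= 1/(n+1)] that cannot be halved at distance
[n * eps_n]. They form an asymptotic homomorphism, and their cochains [alpha_n],
made homogeneous, represent an asymptotic 2-cocycle ([curvature_cochain]). Since
it is a coboundary, [bounding_cochain] provides cochains [b_n] which bound the
[alpha_n] along the ultrafilter, and correcting [phi_n] by
[beta_n x = b_n (1, x)] contradicts the choice of [phi_n] for some [n]. Hence
[defect_diminishing]: below a threshold, every defect can be halved at a distance
proportional to it.

Iterating, the successive distances decay geometrically. Every norm of the family
is equivalent to the largest entry, so the iterates converge in the unitary group
to a homomorphism, at distance at most [2 K eps] ([diminishing_stable]).

The constants of the Newton step must be the same for all dimensions and norms. In
particular the norm of the identity, which is unbounded over the family, must not
occur in them. The estimates therefore rely only on unitary invariance,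
submultiplicativity and the exact quadratic remainders of [antiherm_part] and
[cayley_transform]. *)

(** * Unitary matrices near the identity *)

Lemma conjC_real (R : realType) (r : R) : Num.conj (r%:C : R[i]) = r%:C.
Proof. exact: conjc_real. Qed.

Section NearIdentity.
Variables (R : realType) (n : nat) (N : unitary_norm R n).
Implicit Types (A B C : 'M[R[i]]_n) (u v : unitary R n) (a : antiherm R n).

Lemma unorm_mulul u A : N (u *m A) = N A.
Proof. by rewrite -[u *m A]mulmx1 (unorm_biinv N u (unitary_one R n)). Qed.

Lemma unorm_mulur A u : N (A *m u) = N A.
Proof.
by rewrite -[A *m u]mul1mx mulmxA (unorm_biinv N (unitary_one R n) u).
Qed.

Lemma unorm_distC A B : N (A - B) = N (B - A).
Proof. by rewrite -unormN opprB. Qed.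

Lemma unorm_dist_trans B A C : N (A - C) <= N (A - B) + N (B - C).
Proof. by rewrite -[A - C](subrKA B) unormD. Qed.

Lemma unorm_eq_le A B : A = B -> N A <= N B.
Proof. by move=> ->. Qed.

Lemma unorm_scale (r : R) A : 0 <= r -> N (r%:C *: A) = r * N A.
Proof. by move=> r0; rewrite unormZ ger0_norm // ler0c. Qed.

Lemma unitarymxC u : u *m (u : 'M_n)^t* = 1%:M.
Proof. exact/unitarymxP/unitary_mxP. Qed.

Lemma unorm_unitaryV1 u : N ((u : 'M_n)^t* - 1%:M) = N ((u : 'M_n) - 1%:M).
Proof. by rewrite -(unorm_mulul u) mulmxBr unitarymxC mulmx1 unorm_distC. Qed.

(** The defect of additivity is exactly [(A - 1) (B - 1)]: to second order,
multiplying matrices near 1 adds their deviations from 1. *)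
Lemma unorm_mul_near1 A B :
  N (A *m B - 1%:M - (A - 1%:M) - (B - 1%:M)) <= N (A - 1%:M) * N (B - 1%:M).
Proof.
rewrite [X in N X](_ : _ = (A - 1%:M) *m (B - 1%:M)) ?unormM //.
rewrite mulmxBl !mulmxBr !mulmx1 !mul1mx.
move: (A *m B) (1%:M) => X Y; apply/matrixP => i j; rewrite !mxE; ring.
Qed.

Lemma antiherm_scale_subproof (r : R) a :
  r%:C *: (a : 'M_n) \in @antihermmx R n.
Proof.
have /eqP aE := antiherm_mxP a; rewrite inE; apply/eqP.
by rewrite linearZ map_mxZ /= aE scalerN conjC_real.
Qed.
Definition antiherm_scale r a := AntiHerm (antiherm_scale_subproof r a).

Lemma antiherm_part_subproof u :
  (2^-1)%:C *: ((u : 'M_n) - (u : 'M_n)^t*) \in @antihermmx R n.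
Proof.
rewrite inE; apply/eqP.
rewrite linearZ map_mxZ /= linearB map_mxB trmxCK /= conjC_real.
by rewrite -scalerN opprB.
Qed.
(** A substitute for the logarithm of a unitary matrix near 1, with the same
first-order expansion. *)
Definition antiherm_part u := AntiHerm (antiherm_part_subproof u).

Lemma unorm_antiherm_part u : N (antiherm_part u) <= N ((u : 'M_n) - 1%:M).
Proof.
rewrite /= unorm_scale ?invr_ge0 // ler_pdivrMl // mulr2n mulrDl mul1r.
apply: le_trans (unorm_dist_trans 1%:M _ _) _.
by rewrite [X in _ + X]unorm_distC unorm_unitaryV1.
Qed.

(** For unitary [u] the remainder is the Hermitian part of [u - 1], which equals
[- (u - 1) (u - 1)^* / 2]. *)
Lemma unorm_unitary_antiherm_part u :
  N ((u : 'M_n) - 1%:M - antiherm_part u) <= N ((u : 'M_n) - 1%:M) ^+ 2 / 2.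
Proof.
rewrite [X in N X](_ : _ =
  - ((2^-1)%:C *: (((u : 'M_n) - 1%:M) *m ((u : 'M_n)^t* - 1%:M)))).
  rewrite unormN unorm_scale ?invr_ge0 // mulrC ler_pM2r ?invr_gt0 // expr2.
  by apply: le_trans (unormM _ _ _) _; rewrite unorm_unitaryV1.
rewrite mulmxBl !mulmxBr unitarymxC !mulmx1 mul1mx /=.
move: ((u : 'M_n)^t*) (1%:M) (unitary_mx u) => X Y Z.
apply/matrixP => i j; rewrite !mxE.
have -> : (2^-1)%:C = 2^-1 :> R[i] by rewrite fmorphV rmorph_nat.
by field.
Qed.

(** A row vector killed by [1 - A] is fixed by [A]; hence the kernel matrix [K]
satisfies [K = K A], and submultiplicativity forces it to vanish. *)
Lemma unit_1sub A : N A < 1 -> 1%:M - A \in unitmx.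
Proof.
move=> A1; rewrite -row_free_unit -kermx_eq0; apply/eqP/(@unorm0_eq0 _ _ N).
set K := kermx _; have KA : K = K *m A.
  by apply/eqP; rewrite -subr_eq0 -[X in X - _]mulmx1 -mulmxBr mulmx_ker.
apply/eqP; rewrite eq_le unorm_ge0 andbT leNgt; apply/negP => K0.
by have := unormM N K A; rewrite -KA leNgt gtr_pMr ?A1.
Qed.

(** Substitute for the exponential. With [h = a / 2] the unitary matrix
[w = (1 + h) (1 - h)^-1] satisfies [w = 1 + h + h w], so the remainder
[w - 1 - a] equals [h h + h h w]; as [w] is unitary, this has norm at most
[2 N(h)^2], and the possibly large norm of [(1 - h)^-1] never enters. *)
Lemma cayley_transform a : N a < 2 ->
  exists w : unitary R n, N ((w : 'M_n) - 1%:M - a) <= N a ^+ 2 / 2.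
Proof.
move=> a2.
have [h [Nh ah hE]] : exists h : 'M[R[i]]_n,
    [/\ N h = N a / 2, a = h + h :> 'M_n & h^t* = - h].
  exists (antiherm_scale 2^-1 a); split; last exact/eqP/antiherm_mxP.
    by rewrite unorm_scale ?invr_ge0 // mulrC.
  by rewrite /= -scalerDl -rmorphD (_ : 2^-1 + 2^-1 = 1) ?scale1r //; field.
have hU : 1%:M - h \in unitmx by rewrite unit_1sub // Nh ltr_pdivrMr ?mul1r.
pose K := invmx (1%:M - h); pose W := (1%:M + h) *m K.
have KE : (1%:M - h) *m K = 1%:M by exact: mulmxV.
have comm : (1%:M - h) *m (1%:M + h) = (1%:M + h) *m (1%:M - h).
  rewrite !(mulmxDl, mulmxDr, mulNmx, mulmxN, mulmx1, mul1mx).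
  move: (_ *m _) (1%:M) => X Y; apply/matrixP => i j; rewrite !mxE; ring.
have subC : (1%:M - h)^t* = 1%:M + h.
  by rewrite [(_ - _)^T]linearB map_mxB /= hE trmx1 map_mx1 opprK.
have addC : (1%:M + h)^t* = 1%:M - h.
  by rewrite [(_ + _)^T]linearD map_mxD /= hE trmx1 map_mx1.
have KC : K^t* *m (1%:M + h) = 1%:M.
  by rewrite -subC -map_mxM -trmx_mul KE trmx1 map_mx1.
have WU : W \is unitarymx.
  apply/unitarymxP/mulmx1C; rewrite trmx_mul map_mxM addC.
  by rewrite -mulmxA (mulmxA _ _ K) comm -(mulmxA _ _ K) KE mulmx1.
(* This is (1 - h) W = 1 + h. *)
have WE : W = 1%:M + h + h *m W.
  by rewrite -[W in LHS](subrK (h *m W)) -[X in X - _]mul1mx -mulmxBl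
    mulmxA comm -mulmxA KE mulmx1.
exists (Unitary WU) => /=.
rewrite [X in N X](_ : _ = h *m h + h *m h *m Unitary WU).
  apply: le_trans (unormD _ _ _) _; rewrite unorm_mulur.
  have := unormM N h h; rewrite Nh => hh.
  apply: le_trans (lerD hh hh) _; lra.
rewrite ah /= -mulmxA {1}WE {1}WE !mulmxDr mulmx1.
move: (h *m (h *m W)) (h *m h) (1%:M) => X Y Z.
apply/matrixP => i j; rewrite !mxE; ring.
Qed.

Lemma unormD_le A B r s : N A <= r -> N B <= s -> N (A + B) <= r + s.
Proof. by move=> Ar Bs; apply: le_trans (unormD _ _ _) (lerD Ar Bs). Qed.

Lemma unormB_le A B r s : N A <= r -> N B <= s -> N (A - B) <= r + s.
Proof. by move=> Ar Bs; apply: le_trans (unormB _ _ _) (lerD Ar Bs). Qed.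

Lemma unitary_dist_mull u v w :
  N (unitary_mx (u * v)%g - unitary_mx (u * w)%g) =
  N (unitary_mx v - unitary_mx w).
Proof. by rewrite -mulmxBr unorm_mulul. Qed.

Lemma unitary_dist_mulr u v w :
  N (unitary_mx (v * u)%g - unitary_mx (w * u)%g) =
  N (unitary_mx v - unitary_mx w).
Proof. by rewrite -mulmxBl unorm_mulur. Qed.

Lemma unitary_distV u v :
  N (unitary_mx u^-1%g - unitary_mx v^-1%g) = N (unitary_mx u - unitary_mx v).
Proof.
rewrite -(unitary_dist_mull u) -(unitary_dist_mulr v) mulgV mul1g -mulgA mulVg.
by rewrite mulg1 unorm_distC.
Qed.

Lemma unitary_dist1 u v :
  N (unitary_mx (u * v^-1)%g - 1%:M) = N (unitary_mx u - unitary_mx v).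
Proof.
rewrite -[1%:M]/(unitary_mx 1%g) -[in LHS](mulgV v).
exact: unitary_dist_mulr.
Qed.

Lemma antiherm_part_conj w u :
  antiherm_conj w (antiherm_part u) = antiherm_part (w * u * w^-1)%g.
Proof.
apply/val_inj; rewrite /= -scalemxAr -scalemxAl mulmxBr mulmxBl.
by rewrite !trmx_mul !map_mxM trmxCK !mulmxA.
Qed.

Lemma antiherm_conj_dist u v a :
  N (antiherm_mx (antiherm_conj u a) - antiherm_mx (antiherm_conj v a)) <=
  2 * N (unitary_mx u - unitary_mx v) * N a.
Proof.
rewrite (_ : _ - _ = (unitary_mx u - unitary_mx v) *m a *m u^-1%g +
    v *m (antiherm_mx a *m (unitary_mx u^-1%g - unitary_mx v^-1%g))).
  rewrite mulr2n !mulrDl !mul1r; apply: unormD_le.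
    by rewrite unorm_mulur unormM.
  by rewrite unorm_mulul -unitary_distV mulrC unormM.
by rewrite !mulmxBr !mulmxBl !mulmxA addrA subrK.
Qed.

Lemma antiherm_conj_mul u v a :
  antiherm_conj u (antiherm_conj v a) = antiherm_conj (u * v)%g a.
Proof. by apply/val_inj; rewrite /= trmx_mul map_mxM !mulmxA. Qed.

Lemma antiherm_scaleE (r : R) a :
  antiherm_scale r a = r%:C *: antiherm_mx a :> 'M_n.
Proof. by []. Qed.

Lemma antiherm_conj_scale (r : R) u a :
  antiherm_conj u (antiherm_scale r a) = antiherm_scale r (antiherm_conj u a).
Proof. by apply/val_inj; rewrite /= -scalemxAr -scalemxAl. Qed.

(** The anti-Hermitian parts inherit to second order the additive relation that
[unorm_mul_near1] extracts from a multiplicative one. The order of the terms is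
that of the cocycle identity of [mult_error_cocycle]. *)
Lemma antiherm_part_mul4 (u1 u2 v1 v2 : unitary R n) (e : R) :
  (u1 * u2 = v1 * v2)%g ->
  N (unitary_mx u1 - 1%:M) <= e -> N (unitary_mx u2 - 1%:M) <= e ->
  N (unitary_mx v1 - 1%:M) <= e -> N (unitary_mx v2 - 1%:M) <= e ->
  N (antiherm_mx (antiherm_part v1) - antiherm_mx (antiherm_part u2) +
     antiherm_mx (antiherm_part v2) - antiherm_mx (antiherm_part u1))
  <= 4 * e ^+ 2.
Proof.
move=> uv u1e u2e v1e v2e.
have {}uv : u1 *m u2 = v1 *m v2 :> 'M_n := congr1 (@unitary_mx R n) uv.
have sq u : N (unitary_mx u - 1%:M) <= e ->
    N (unitary_mx u - 1%:M - antiherm_mx (antiherm_part u)) <= e ^+ 2 / 2.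
  move=> ue; apply: le_trans (unorm_unitary_antiherm_part _) _.
  by rewrite ler_pM2r ?invr_gt0 // lerXn2r ?nnegrE // ?unorm_ge0 //;
    apply: le_trans ue; rewrite unorm_ge0.
have pr A B : N (A - 1%:M) <= e -> N (B - 1%:M) <= e ->
    N (A *m B - 1%:M - (A - 1%:M) - (B - 1%:M)) <= e ^+ 2.
  move=> Ae Be; apply: le_trans (unorm_mul_near1 _ _) _.
  by rewrite expr2 ler_pM ?unorm_ge0.
have := unormB_le (pr _ _ u1e u2e) (pr _ _ v1e v2e); rewrite uv.
have := unormB_le (unormD_le (sq _ u1e) (sq _ u2e))
                  (unormD_le (sq _ v1e) (sq _ v2e)).
move=> X Y; have := unormD_le X Y.
rewrite [X in _ <= X](_ : _ = 4 * e ^+ 2); last by field.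
apply: le_trans; apply: unorm_eq_le.
move: (_ *m _) (antiherm_mx _) (antiherm_mx (antiherm_part u2))
  (antiherm_mx (antiherm_part v1)) (antiherm_mx (antiherm_part v2)).
move: (unitary_mx u1) (unitary_mx u2) (unitary_mx v1) (unitary_mx v2) (1%:M).
move=> *; apply/matrixP => i j; rewrite !mxE; ring.
Qed.

End NearIdentity.

(** * The curvature of an almost homomorphism and its correction *)

Section Correction.
Variables (R : realType) (Gamma : groupType) (n : nat) (N : unitary_norm R n).
Variables (phi : Gamma -> unitary R n) (e : R).
Hypothesis phi_e : forall x y,
  N (unitary_mx (phi (x * y)%g) - unitary_mx (phi x * phi y)%g) <= e.
Hypothesis e_gt0 : 0 < e.

Definition mult_error x y : unitary R n := (phi x * phi y * (phi (x * y))^-1)%g.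

Lemma mult_error_near1 x y : N (unitary_mx (mult_error x y) - 1%:M) <= e.
Proof. by rewrite unitary_dist1 unorm_distC. Qed.

(** Both sides are [phi x phi y phi z (phi (x y z))^-1], bracketed differently. *)
Lemma mult_error_cocycle x y z :
  (mult_error x y * mult_error (x * y) z =
   (phi x * mult_error y z * (phi x)^-1) * mult_error x (y * z))%g.
Proof.
rewrite /mult_error -!mulgA; congr (_ * (_ * _))%g.
by rewrite !mulKg.
Qed.

(** The first-order coefficient of the multiplicative error, normalized by [e] so
as to stay bounded when the defect tends to 0. *)
Definition curvature x y : antiherm R n :=
  antiherm_scale e^-1 (antiherm_part (mult_error x y)).

Lemma curvature_le1 x y : N (curvature x y) <= 1.
Proof.
rewrite unorm_scale ?invr_ge0 ?(ltW e_gt0) // ler_pdivrMl // mulr1.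
exact: le_trans (unorm_antiherm_part _ _) (mult_error_near1 x y).
Qed.

Lemma mult_error_curvature x y :
  N (unitary_mx (mult_error x y) - 1%:M - e%:C *: antiherm_mx (curvature x y))
  <= e ^+ 2 / 2.
Proof.
rewrite [e%:C *: _](_ : _ = antiherm_mx (antiherm_part (mult_error x y)));
  last first.
  by rewrite [LHS]scalerA -rmorphM divff ?gt_eqF // rmorph1 scale1r.
apply: le_trans (unorm_unitary_antiherm_part _ _) _.
have := mult_error_near1 x y.
have := unorm_ge0 N (unitary_mx (mult_error x y) - 1%:M).
by move: (N _) => r r0 re; rewrite ler_pM2r ?invr_gt0 // lerXn2r ?nnegrE // ltW.
Qed.

Lemma curvature_cocycle x y z :
  N (antiherm_mx (antiherm_conj (phi x) (curvature y z))
     - antiherm_mx (curvature (x * y)%g z)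
     + antiherm_mx (curvature x (y * z)%g) - antiherm_mx (curvature x y))
  <= 4 * e.
Proof.
have conj1 : N (unitary_mx (phi x * mult_error y z * (phi x)^-1)%g - 1%:M) <= e.
  rewrite unitary_dist1 -[X in _ - unitary_mx X]mulg1 unitary_dist_mull.
  exact: mult_error_near1.
have := antiherm_part_mul4 (mult_error_cocycle x y z) (mult_error_near1 _ _)
  (mult_error_near1 _ _) conj1 (mult_error_near1 _ _).
rewrite -antiherm_part_conj /curvature antiherm_conj_scale => H.
have -> : 4 * e = e^-1 * (4 * e ^+ 2) by field; rewrite gt_eqF.
rewrite !antiherm_scaleE -scalerBr -scalerDr -scalerBr.
by rewrite unorm_scale ?invr_ge0 ?(ltW e_gt0) // ler_pM2l ?invr_gt0.
Qed.

Lemma phi1_near1 : N (unitary_mx (phi 1%g) - 1%:M) <= e.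
Proof.
have := phi_e 1 1; rewrite mulg1 -{1}[phi 1]mulg1 unitary_dist_mull.
by rewrite unorm_distC.
Qed.

(** The Newton step. With [W] the Cayley transform of [- e * beta] and
[psi x = W x phi x], the product [psi x psi y] equals
[W x (phi x W y (phi x)^-1) (mult_error x y) phi (x y)], a product of three
unitaries near 1 whose first-order terms are [- e * beta x],
[- e * phi x (beta y) (phi x)^-1] and [e * curvature x y]. They nearly add up to
the first-order term [- e * beta (x y)] of [W (x y)] because [beta] nearly bounds
the curvature, with error [d]; everything else is quadratic in [e]. *)
Lemma correct_defect (beta : Gamma -> antiherm R n) (C d : R) :
  0 <= C -> e * C < 2 ->
  (forall x, N (beta x) <= C) ->
  (forall x y, N (antiherm_mx (antiherm_conj (phi x) (beta y))
     - antiherm_mx (beta (x * y)%g) + antiherm_mx (beta x)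
     - antiherm_mx (curvature x y)) <= d) ->
  exists psi : Gamma -> unitary R n,
    (forall x, N (unitary_mx (phi x) - unitary_mx (psi x)) <= 2 * C * e) /\
    (forall x y,
      N (unitary_mx (psi (x * y)%g) - unitary_mx (psi x * psi y)%g)
      <= d * e + (6 * C ^+ 2 + 4 * C + 1) * e ^+ 2).
Proof.
move=> C0 eC2 betaC beta_d.
have eC0 : 0 <= e * C by rewrite mulr_ge0 // ltW.
have Nb x : N (antiherm_mx (- antiherm_scale e (beta x))) <= e * C.
  by rewrite unormN unorm_scale ?ler_pM2l // ltW.
have /choice [W WP] : forall x, exists w : unitary R n,
    N (unitary_mx w - 1%:M + e%:C *: antiherm_mx (beta x)) <= (e * C) ^+ 2 / 2.
  move=> x.
  have [w we] := cayley_transform (le_lt_trans (Nb x) eC2).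
  exists w; rewrite /= opprK in we; apply: le_trans we _.
  rewrite ler_pM2r ?invr_gt0 // lerXn2r ?nnegrE ?unorm_ge0 //; exact: Nb.
have W1 x : N (unitary_mx (W x) - 1%:M) <= 2 * C * e.
  rewrite -[X in N X](addrK (e%:C *: antiherm_mx (beta x))).
  have := Nb x; rewrite unormN => bx.
  apply: le_trans (unormB_le (WP x) bx) _.
  by move: (e * C) eC0 eC2 (mulrC e C) => t; nra.
exists (fun x => W x * phi x)%g; split => [x|x y].
  by rewrite -{1}[phi x]mul1g unitary_dist_mulr unorm_distC.
pose W2 := (phi x * W y * (phi x)^-1)%g.
have W2P : N (unitary_mx W2 - 1%:M +
    e%:C *: antiherm_mx (antiherm_conj (phi x) (beta y))) <= (e * C) ^+ 2 / 2.
  apply: le_trans (WP y); rewrite -[leRHS](unorm_biinv N (phi x) (phi x)^-1%g).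
  apply: unorm_eq_le.
  rewrite !(mulmxDr, mulmxDl) mulmxN mulNmx mulmx1 -scalemxAr -scalemxAl.
  by rewrite [X in _ = _ - X + _]unitarymxC.
have W21 : N (unitary_mx W2 - 1%:M) <= 2 * C * e.
  by rewrite unitary_dist1 -[X in _ - unitary_mx X]mulg1 unitary_dist_mull.
pose T := (W x * W2 * mult_error x y)%g.
have -> : N (unitary_mx (W (x * y) * phi (x * y))%g -
    unitary_mx (W x * phi x * (W y * phi y))%g) =
    N (unitary_mx (W (x * y)%g) - unitary_mx T).
  rewrite -[RHS](unitary_dist_mulr N (phi (x * y)%g)).
  congr (N (_ - unitary_mx _)).
  by rewrite /T /W2 /mult_error -!mulgA mulVg mulg1 mulKg.
have W12 : N (unitary_mx (W x * W2)%g - 1%:M) <= 2 * C * e + 2 * C * e.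
  apply: le_trans (unorm_dist_trans _ (unitary_mx (W x)) _ _) _.
  by rewrite addrC lerD // -{2}[W x]mulg1 unitary_dist_mull.
have P12 : N (unitary_mx (W x * W2)%g - 1%:M - (unitary_mx (W x) - 1%:M) -
    (unitary_mx W2 - 1%:M)) <= _ := le_trans (unorm_mul_near1 N (W x) W2)
  (ler_pM (unorm_ge0 _ _) (unorm_ge0 _ _) (W1 x) W21).
have P3 : N (unitary_mx T - 1%:M - (unitary_mx (W x * W2)%g - 1%:M) -
    (unitary_mx (mult_error x y) - 1%:M)) <= _ :=
  le_trans (unorm_mul_near1 N (W x * W2)%g (mult_error x y))
  (ler_pM (unorm_ge0 _ _) (unorm_ge0 _ _) W12 (mult_error_near1 x y)).
have D : N (e%:C *: (antiherm_mx (antiherm_conj (phi x) (beta y))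
     - antiherm_mx (beta (x * y)%g) + antiherm_mx (beta x)
     - antiherm_mx (curvature x y))) <= e * d.
  by rewrite unorm_scale ?ler_pM2l // ltW.
have := unormD_le (unormB_le (unormB_le (WP (x * y)%g) P3)
   (unormD_le (unormD_le P12 (WP x))
              (unormD_le W2P (mult_error_curvature x y)))) D.
(* The exact difference is the sum of the remainders collected so far and of e
   times the defect of the cocycle equation for beta. *)
set bound := (X in _ <= X -> _) => H.
apply: (@le_trans _ _ bound).
  apply: le_trans H; apply: unorm_eq_le.
  rewrite !(scalerDr, scalerBr).
  move: (unitary_mx T) (unitary_mx (W x * W2)%g) (antiherm_mx (curvature x y)).
  move: (antiherm_mx (antiherm_conj _ _)) (antiherm_mx (beta (x * y)%g)).
  move: (antiherm_mx (beta x)) (unitary_mx (W (x * y)%g)) (unitary_mx (W x)).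
  move: (unitary_mx W2) (unitary_mx (mult_error x y)) (1%:M) => *.
  apply/matrixP => i j; rewrite !mxE; ring.
rewrite /bound -subr_ge0 (_ : _ - _ = (e ^+ 2 + (e * C) ^+ 2) / 2).
  by rewrite divr_ge0 ?addr_ge0 ?sqr_ge0.
by field.
Qed.

End Correction.

(** * The curvature as a homogeneous cochain *)

Lemma addr_telescope (V : zmodType) (t p q r s : V) :
  p - q + r - s = p - t + (t - q + r - s).
Proof. by rewrite !addrA subrK. Qed.

Lemma addr_telescope2 (V : zmodType) (t u p q r s : V) :
  p - q + r - s = p - t + (t - q + r - u) + (u - s).
Proof. by rewrite -addr_telescope addrA subrK. Qed.

Lemma antiherm_conj1 (R : realType) n (a : antiherm R n) :
  antiherm_conj 1%g a = a.
Proof. by apply/val_inj; rewrite /= trmx1 map_mx1 mul1mx mulmx1. Qed.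

Section FewPoints.
Variables (R : realType) (Gamma : groupType) (G : ufamily R).

Lemma linf_subE m (f h : linf Gamma G m) x :
  antiherm_mx ((f - h) x) = antiherm_mx (f x) - antiherm_mx (h x).
Proof. by []. Qed.

(** Points of [Gamma ^ m] given by the list of their coordinates, so that the faces
of a simplex reduce to explicit lists. *)
Definition seq_point m (s : seq Gamma) : 'I_m -> Gamma := fun i => nth 1%g s i.

Lemma seq_point_surj m (x : 'I_m -> Gamma) :
  exists2 s, size s = m & x = seq_point s.
Proof.
exists (codom x); first by rewrite size_codom card_ord.
apply/funext => i.
by rewrite /seq_point (nth_map i) ?nth_ord_enum ?size_enum_ord.
Qed.

Lemma linf_act_seq_point m phi g (f : linf Gamma G m) s : size s = m ->
  linf_act phi g f (seq_point s) =
  antiherm_conj (phi g) (f (seq_point [seq g^-1 * h | h <- s]%g)).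
Proof.
move=> sm; rewrite [LHS]/= /act_fun; congr (antiherm_conj _ (f _)).
by apply/funext => i; rewrite /seq_point (nth_map 1%g) ?sm.
Qed.

Lemma linf_diff2 (f : linf Gamma G 2) a b c :
  antiherm_mx (linf_diff f (seq_point [:: a; b; c])) =
  antiherm_mx (f (seq_point [:: b; c])) -
  antiherm_mx (f (seq_point [:: a; c])) +
  antiherm_mx (f (seq_point [:: a; b])).
Proof.
rewrite [linf_fun _]/= /diff_fun !big_ord_recl big_ord0 /= addr0 addrA.
by congr (_ - _ + _); congr (antiherm_mx (f _)); apply/funext;
  move=> [[|[|]]].
Qed.

Lemma linf_diff3 (f : linf Gamma G 3) a b c d :
  antiherm_mx (linf_diff f (seq_point [:: a; b; c; d])) =
  antiherm_mx (f (seq_point [:: b; c; d])) -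
  antiherm_mx (f (seq_point [:: a; c; d])) +
  antiherm_mx (f (seq_point [:: a; b; d])) -
  antiherm_mx (f (seq_point [:: a; b; c])).
Proof.
rewrite [linf_fun _]/= /diff_fun !big_ord_recl big_ord0 /= addr0 !addrA.
by congr (_ - _ + _ - _); congr (antiherm_mx (f _)); apply/funext;
  move=> [[|[|[|]]]].
Qed.

End FewPoints.

Section CurvatureCochain.
Variables (R : realType) (Gamma : groupType) (G : ufamily R).
Let N := unrm G.
Variables (phi : Gamma -> unitary R (udim G)) (e : R).
Hypothesis phi_e : forall x y,
  N (unitary_mx (phi (x * y)%g) - unitary_mx (phi x * phi y)%g) <= e.
Hypothesis e_gt0 : 0 < e.

(** The usual passage from inhomogeneous to homogeneous cochains:
[c (x, x y, x y z) = x . alpha (y, z)]. *)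
Definition homogeneous_curvature (x : 'I_3 -> Gamma) : antiherm R (udim G) :=
  antiherm_conj (phi (x (inord 0)))
    (curvature phi e ((x (inord 0))^-1 * x (inord 1))%g
                     ((x (inord 1))^-1 * x (inord 2))%g).

Lemma homogeneous_curvature_le1 x : N (homogeneous_curvature x) <= 1.
Proof. by rewrite unorm_conj; exact: curvature_le1. Qed.

Lemma homogeneous_curvature_subproof :
  homogeneous_curvature \in @linf_pred R Gamma G 3.
Proof. by apply/asboolP; exists 1; exact: homogeneous_curvature_le1. Qed.

Definition curvature_cochain : linf Gamma G 3 :=
  Linf homogeneous_curvature_subproof.

Lemma curvature_cochainE a b c : curvature_cochain (seq_point [:: a; b; c]) =
  antiherm_conj (phi a) (curvature phi e (a^-1 * b) (b^-1 * c)).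
Proof. by rewrite [LHS]/= /homogeneous_curvature /seq_point !inordK. Qed.

Lemma sup_norm_curvature_cochain : sup_norm curvature_cochain <= 1.
Proof. by apply: sup_norm_le; exact: homogeneous_curvature_le1. Qed.

(** Since [phi] is only almost multiplicative, conjugation by [phi] is only almost an
action; on the bounded curvature the discrepancy is [O(e)]. *)
Lemma conj_curvature_dist (u v : unitary R (udim G)) x y :
  N (unitary_mx u - unitary_mx v) <= e ->
  N (antiherm_mx (antiherm_conj u (curvature phi e x y)) -
     antiherm_mx (antiherm_conj v (curvature phi e x y))) <= 2 * e.
Proof.
move=> uv; apply: le_trans (antiherm_conj_dist _ _ _ _) _.
rewrite -[2 * e]mulr1 ler_pM ?mulr_ge0 ?unorm_ge0 ?ler_pM2l //.
exact: curvature_le1.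
Qed.

Lemma curvature_cochain_act g :
  sup_norm (linf_act phi g curvature_cochain - curvature_cochain) <= 2 * e.
Proof.
apply: sup_norm_le => x.
have [[|a [|b [|c []]]] // s3 ->] := seq_point_surj x.
rewrite linf_subE linf_act_seq_point // !curvature_cochainE antiherm_conj_mul.
rewrite !invgM !invgK -!mulgA !mulVKg; apply: conj_curvature_dist.
by rewrite unorm_distC -{1}[a](mulVKg g).
Qed.

Lemma curvature_cochain_diff : sup_norm (linf_diff curvature_cochain) <= 6 * e.
Proof.
apply: sup_norm_le => x.
have [[|a [|b [|c [|d []]]]] // s4 ->] := seq_point_surj x.
rewrite linf_diff3 !curvature_cochainE.
set y := (b^-1 * c)%g; set z := (c^-1 * d)%g.
have -> : (a^-1 * c = a^-1 * b * y)%g by rewrite -mulgA mulVKg.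
have -> : (b^-1 * d = y * z)%g by rewrite -mulgA mulVKg.
have yz := conj_curvature_dist y z (phi_e a (a^-1 * b)).
have cc := curvature_cocycle phi_e e_gt0 (a^-1 * b) y z.
rewrite mulVKg -antiherm_conj_mul in yz.
(* The cocycle identity at (x, y, z) is transported by phi a. *)
rewrite -(unorm_biinv _ (phi a) (phi a)^-1%g) in cc.
have := unormD_le yz cc; rewrite (_ : 2 * e + 4 * e = 6 * e); last by ring.
apply: le_trans; apply: unorm_eq_le.
have E (p q r s : antiherm R (udim G)) :
    phi a *m (antiherm_mx p - antiherm_mx q + antiherm_mx r - antiherm_mx s)
      *m (phi a)^-1%g =
    antiherm_mx (antiherm_conj (phi a) p) -
    antiherm_mx (antiherm_conj (phi a) q) +
    antiherm_mx (antiherm_conj (phi a) r) -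
    antiherm_mx (antiherm_conj (phi a) s).
  case: p q r s => [p _] [q _] [r _] [s _] /=.
  by rewrite mulmxBr mulmxDr mulmxBr mulmxBl mulmxDl mulmxBl.
rewrite E; exact: addr_telescope.
Qed.

(** Back to inhomogeneous cochains: [beta x = b (1, x)]. The equation for [beta] is
the one for [b] on the simplex [(1, x, x y)], where almost invariance replaces
[b (x, x y)] by [x . b (1, y)]. *)
Lemma bounding_cochain_curvature (b : linf Gamma G 2) (d : R) :
  (forall g, sup_norm (linf_act phi g b - b) <= d) ->
  sup_norm (linf_diff b - curvature_cochain) <= d ->
  exists beta : Gamma -> antiherm R (udim G),
    (forall x, N (beta x) <= sup_norm b) /\
    (forall x y, N (antiherm_mx (antiherm_conj (phi x) (beta y))
      - antiherm_mx (beta (x * y)%g) + antiherm_mx (beta x)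
      - antiherm_mx (curvature phi e x y)) <= 2 * d + 2 * e).
Proof.
move=> b_act b_diff.
exists (fun x => b (seq_point [:: 1%g; x])); split=> [x|x y].
  exact: sup_norm_ub.
have A := le_trans (sup_norm_ub _ (seq_point [:: x; (x * y)%g])) (b_act x).
rewrite linf_subE linf_act_seq_point //= mulVg mulKg in A.
have B := le_trans (sup_norm_ub _ (seq_point [:: 1%g; x; (x * y)%g])) b_diff.
rewrite linf_subE linf_diff2 curvature_cochainE invg1 mul1g mulKg in B.
have C := conj_curvature_dist (v := 1%g) x y (phi1_near1 phi_e).
rewrite antiherm_conj1 in C.
have := unormD_le (unormD_le A B) C.
rewrite (_ : d + d + 2 * e = 2 * d + 2 * e); last by ring.
apply: le_trans; apply: unorm_eq_le; exact: addr_telescope2.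
Qed.

End CurvatureCochain.

(** * From asymptotic cohomology to sequences of cochains *)

Section Transfer.
Variables (R : realType) (Gamma : groupType) (U : free_ultrafilter).

(** A property that holds along the ultrafilter for every internal element holds
uniformly: test it on a sequence of counterexamples. *)
Lemma ultra_uniform (X : Type) (P : nat -> X -> Prop) (x0 : X) :
  (forall x : nat -> X, U [set n | P n (x n)]) ->
  U [set n | forall x, P n x].
Proof.
move=> UP.
have /choice [x xP] : forall n, exists x : X, P n x -> forall y, P n y.
  move=> n; have [[x Px]|noneP] := pselect (exists x, ~ P n x).
    by exists x => /Px.
  by exists x0 => _ y; apply: contrapT => Py; apply: noneP; exists y.
by apply: filterS (UP x) => n; exact: xP.
Qed.

Variable phi : asym_hom R Gamma U.
Let fam := asym_fam phi.

Lemma tLinf_eqP m (f h : Linf_b phi m)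
    (f' h' : forall n, linf Gamma (fam n) m) :
  Linf_b_val f = uclass U f' -> Linf_b_val h = uclass U h' ->
  \pi_(tLinf phi m) f = \pi_(tLinf phi m) h <->
  forall e, 0 < e -> U [set n | sup_norm (f' n - h' n) <= e].
Proof.
move=> fE hE.
have fhE : U [set n | urepr (Linf_b_val (f - h)) n = f' n - h' n].
  by rewrite -uclass_eq ureprK -uclassB -fE -hE.
split=> [/eqP|fh].
  rewrite -Quotient.idealrBE => /Linf_infE fh e /fh.
  by apply: filterS2 fhE => n /= ->.
apply/eqP; rewrite -Quotient.idealrBE; apply/Linf_infE => e /fh.
by apply: filterS2 fhE => n /= ->.
Qed.

(** Invariance under the internal group [ustar Gamma U] amounts to almost invariance
uniformly over [Gamma], because an internal group element is an arbitrary
sequence. *)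
Lemma tact_fixedP m (f : Linf_b phi m) (f' : forall n, linf Gamma (fam n) m) :
  Linf_b_val f = uclass U f' ->
  (forall g, tact g (\pi_(tLinf phi m) f) = \pi_(tLinf phi m) f) <->
  forall e, 0 < e -> U [set n | forall g,
    sup_norm (linf_act (@asym_map _ _ _ phi n) g (f' n) - f' n) <= e].
Proof.
move=> fE.
have actE (g : nat -> Gamma) : Linf_b_val (Linf_b_act (uclass U g) f) =
    uclass U (fun n => linf_act (@asym_map _ _ _ phi n) (g n) (f' n)).
  by rewrite /= fE /Linf_act ulift2E.
split=> [fixf e e0|fixf g].
  apply: (ultra_uniform 1%g) => g.
  have := fixf (uclass U g).
  by rewrite tactE => /(tLinf_eqP (actE g) fE) /(_ e e0).
rewrite -[g]ureprK tactE; apply/(tLinf_eqP (actE _) fE) => e /fixf.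
by apply: filterS => n /= fg; exact: fg.
Qed.

Lemma tdiff_eqP m (f : Linf_b phi m) (h : Linf_b phi m.+1)
    (f' : forall n, linf Gamma (fam n) m)
    (h' : forall n, linf Gamma (fam n) m.+1) :
  Linf_b_val f = uclass U f' -> Linf_b_val h = uclass U h' ->
  tdiff (\pi_(tLinf phi m) f) = \pi_(tLinf phi m.+1) h <->
  forall e, 0 < e -> U [set n | sup_norm (linf_diff (f' n) - h' n) <= e].
Proof.
move=> fE hE; rewrite tdiffE; apply: tLinf_eqP hE.
by rewrite /= fE /Linf_diff ulift1E.
Qed.

(** Vanishing of cohomology in terms of sequences of genuine cochains: an
asymptotically invariant and closed bounded sequence is asymptotically the
coboundary of an asymptotically invariant bounded sequence. *)
Lemma bounding_cochain m (c : forall n, linf Gamma (fam n) m.+2) (r : R) :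
  (forall a : asym_cohomology phi m.+1, a = 0) ->
  U [set n | sup_norm (c n) <= r] ->
  (forall e, 0 < e -> U [set n | forall g,
    sup_norm (linf_act (@asym_map _ _ _ phi n) g (c n) - c n) <= e]) ->
  (forall e, 0 < e -> U [set n | sup_norm (linf_diff (c n)) <= e]) ->
  exists b : forall n, linf Gamma (fam n) m.+1,
  [/\ exists s, U [set n | sup_norm (b n) <= s],
    forall e, 0 < e -> U [set n | forall g,
      sup_norm (linf_act (@asym_map _ _ _ phi n) g (b n) - b n) <= e] &
    forall e, 0 < e -> U [set n | sup_norm (linf_diff (b n) - c n) <= e]].
Proof.
move=> H0 cr c_fixed c_closed.
have cb : uclass U c \in @Linf_bounded _ _ _ phi m.+2.
  by apply/Linf_boundedE; exists r.
have cE : Linf_b_val (LinfB cb) = uclass U c by [].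
have cF : \pi_(tLinf phi m.+2) (LinfB cb) \in @tLinf_fixed _ _ _ phi m.+1.
  by apply/asboolP/(tact_fixedP cE).
have cZ : Cochain cF \in @is_cocycle _ _ _ phi m.+1.
  apply/eqP/val_inj; rewrite [LHS]/=.
  have zE : Linf_b_val (0 : Linf_b phi m.+3) = uclass U (fun n => 0) by [].
  rewrite [RHS](_ : _ = \pi_(tLinf phi m.+3) 0); last first.
    by rewrite [RHS]raddf0 [LHS]raddf0.
  apply/(tdiff_eqP cE zE) => e /c_closed.
  by apply: filterS => n /=; rewrite subr0.
have : Cocycle cZ \in @is_coboundary _ _ _ phi m.+1.
  rewrite -[Cocycle cZ]subr0 Quotient.idealrBE; apply/eqP.
  by rewrite [LHS]H0 [RHS]H0.
move=> /asboolP[[b bF] /(congr1 (@cochain_val _ _ _ _ _))] /= bc.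
set f := repr b; have fE : Linf_b_val f = uclass U (urepr (Linf_b_val f)).
  by rewrite ureprK.
have bE : b = \pi f by rewrite reprK.
exists (urepr (Linf_b_val f)); split.
- by apply/Linf_boundedE; rewrite ureprK; exact: Linf_b_valP.
- by apply/(tact_fixedP fE); rewrite -bE; exact/asboolP.
- by apply/(tdiff_eqP fE cE); rewrite -bE.
Qed.

End Transfer.

(** * Halving the defect *)

Section Filter.
Variable U : free_ultrafilter.

Lemma free_ultrafilter_neq n : U [set m | m <> n].
Proof.
have [Un|//] := in_ultra_setVsetC [set n] (ultra_setsP U).
case: (@ultra_free U n); apply/funext => A; apply/propext; split=> [UA|An].
  apply/principal_filterP.
  by have /filter_ex[m [Am <-]] : U (A `&` [set n]) by exact: filterI.
by move/principal_filterP: An => An; apply: filterS Un => m ->.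
Qed.

Lemma free_ultrafilter_geq k : U [set n | (k <= n)%N].
Proof.
elim: k => [|k IHk]; first by apply: filterE => n /=.
apply: filterS2 IHk (free_ultrafilter_neq k) => n /= kn nk.
by rewrite ltn_neqAle kn andbT eq_sym; apply/eqP.
Qed.

Lemma free_ultrafilter_invS_le (R : realType) (r : R) : 0 < r ->
  U [set n | n.+1%:R^-1 <= r].
Proof.
move=> r0; apply: filterS (free_ultrafilter_geq (Num.bound r^-1)) => n /= rn.
have ri0 : 0 <= r^-1 by rewrite invr_ge0 ltW.
rewrite -[r]invrK lef_pV2 ?posrE ?invr_gt0 ?ltr0n //.
by apply: ltW; apply: lt_le_trans (archi_boundP ri0) _; rewrite ler_nat leqW.
Qed.

Lemma free_ultrafilter_nat_ge (R : realType) (r : R) : U [set n | r <= n%:R].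
Proof.
apply: filterS (free_ultrafilter_geq (Num.bound `|r|)) => n /= rn.
apply: le_trans (ler_norm r) (ltW _).
by apply: lt_le_trans (archi_boundP (normr_ge0 r)) _; rewrite ler_nat.
Qed.

End Filter.

Section DefectDiminishing.
Variables (R : realType) (U : free_ultrafilter) (Gamma : groupType).

Definition almost_mult (G : ufamily R) (phi : Gamma -> unitary R (udim G)) e :=
  forall x y,
    unrm G (unitary_mx (phi (x * y)%g) - unitary_mx (phi x * phi y)%g) <= e.

Lemma almost_mult_defect G (phi : Gamma -> unitary R (udim G)) e :
  almost_mult phi e -> 0 <= defect phi <= e.
Proof.
move=> phie; apply/andP; split; last first.
  apply: ge_sup; last by move=> _ [[x y] _ <-]; exact: phie.
  by eexists; exists (1%g, 1%g).
apply: le_trans (unorm_ge0 (unrm G) _) (ub_le_sup _ _); last first.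
  by exists (1%g, 1%g).
by exists e => _ [[x y] _ <-]; exact: phie.
Qed.

Definition improvable (G : ufamily R) (phi : Gamma -> unitary R (udim G)) e K :=
  exists psi : Gamma -> unitary R (udim G),
    (forall x, unrm G (unitary_mx (phi x) - unitary_mx (psi x)) <= K * e) /\
    almost_mult psi (e / 2).

(** Compactness argument: counterexamples to the constants [1 / (n + 1)] and [n]
assemble into an asymptotic homomorphism, to which the vanishing of cohomology
applies. The normalization of the curvature requires [e] to be positive; this is no
loss, since a map with [e = 0] improves itself. *)
Lemma defect_diminishing :
  (forall (phi : asym_hom R Gamma U) (c : asym_cohomology phi 2), c = 0) ->
  exists e1 K : R, [/\ 0 < e1, 0 <= K &
    forall e, 0 <= e -> e <= e1 ->
    forall (G : ufamily R) (phi : Gamma -> unitary R (udim G)),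
      almost_mult phi e -> improvable phi e K].
Proof.
move=> H2; apply: contrapT => noK.
have /choice[t tP] : forall n, exists t :
    R * {G : ufamily R & Gamma -> unitary R (udim G)},
    [/\ 0 < t.1, t.1 <= n.+1%:R^-1, almost_mult (tagged t.2) t.1 &
      ~ improvable (tagged t.2) t.1 n%:R].
  move=> n; apply: contrapT => not_n; apply: noK.
  exists n.+1%:R^-1, n%:R; split; rewrite ?invr_gt0 ?ltr0n //.
  move=> e e0 en G phi phie; apply: contrapT => nimp; apply: not_n.
  exists (e, Tagged (fun G => Gamma -> unitary R (udim G)) phi); split=> //=.
  rewrite lt_neqAle e0 andbT eq_sym; apply/eqP => e_eq0; apply: nimp.
  exists phi; split=> [x|x y]; first by rewrite subrr unorm0 e_eq0 mulr0.
  by apply: le_trans (phie x y) _; rewrite e_eq0 mul0r.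
pose eps n := (t n).1; pose fam n := tag (t n).2.
pose map n : Gamma -> unitary R (udim (fam n)) := tagged (t n).2.
have eps_gt0 n : 0 < eps n by have [] := tP n.
have map_eps n : almost_mult (map n) (eps n) by have [] := tP n.
have eps_le r : 0 < r -> U [set n | eps n <= r].
  move=> /(free_ultrafilter_invS_le U); apply: filterS => n /=.
  by apply: le_trans; have [] := tP n.
have map_defect : infinitesimal (uclass U (fun n => defect (map n))).
  apply/infinitesimalE => r /eps_le; apply: filterS => n /=.
  have /andP[d0 de] := almost_mult_defect (map_eps n).
  by rewrite ger0_norm //; exact: le_trans.
pose phi := AsymHom map_defect.
pose c n := curvature_cochain (map_eps n) (eps_gt0 n).
have small (k r : R) : 0 < k -> 0 < r -> U [set n | k * eps n <= r].
  move=> k0 r0; have /eps_le : 0 < r / k by rewrite divr_gt0.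
  by apply: filterS => n /=; rewrite ler_pdivlMr // mulrC.
have [b [[s bs] b_act b_diff]] : exists b : forall n, linf Gamma (fam n) 2,
    [/\ exists s, U [set n | sup_norm (b n) <= s],
    forall e, 0 < e -> U [set n | forall g,
      sup_norm (linf_act (@map n) g (b n) - b n) <= e] &
    forall e, 0 < e -> U [set n | sup_norm (linf_diff (b n) - c n) <= e]].
  apply: (@bounding_cochain _ _ _ phi 1 c 1 (H2 phi)).
  - by apply: filterE => n /=; exact: sup_norm_curvature_cochain.
  - move=> r /(small 2 r (ltr0Sn _ 1)); apply: filterS => n /= er g.
    exact: le_trans (curvature_cochain_act _ _ _) er.
  - move=> r /(small 6 r (ltr0Sn _ 5)); apply: filterS => n /= er.
    exact: le_trans (curvature_cochain_diff _ _) er.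
(* Correcting with d = 2/16 + 2 e gives a defect at most
   e * (1/8 + (6 C^2 + 4 C + 3) * e), whence the thresholds 1/16 and 3/8. *)
pose C := `|s|; have C0 : 0 <= C by exact: normr_ge0.
pose Q := 6 * C ^+ 2 + 4 * C + 3.
have CQ : C + 1 <= Q.
  by rewrite /Q; have := sqr_ge0 C; move: (C) C0 => r r0; lra.
have Q0 : 0 < Q by lra.
have d0 : 0 < 16^-1 :> R by rewrite invr_gt0.
have q0 : 0 < 3 / 8 :> R by rewrite divr_gt0.
have /filter_ex[n [[[[/= bn actn] diffn] epsn] nC]] : U (
    [set n | sup_norm (b n) <= s] `&`
    [set n | forall g, sup_norm (linf_act (@map n) g (b n) - b n) <= 16^-1] `&`
    [set n | sup_norm (linf_diff (b n) - c n) <= 16^-1] `&`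
    [set n | Q * eps n <= 3 / 8] `&` [set n | 2 * C <= n%:R]).
  apply: filterI (free_ultrafilter_nat_ge U (2 * C)).
  apply: filterI (small _ _ Q0 q0); apply: filterI (b_diff _ d0).
  exact: filterI bs (b_act _ d0).
have [_ _ _] := tP n; apply.
have [beta [betaC beta_d]] := bounding_cochain_curvature actn diffn.
have betaC' x : unrm (fam n) (beta x) <= C.
  by apply: le_trans (betaC x) (le_trans bn (ler_norm s)).
have e0 := eps_gt0 n.
have eC2 : eps n * C < 2.
  have : (C + 1) * eps n <= Q * eps n by rewrite ler_pM2r.
  move: (eps n) (Q) (C) e0 epsn => r p q r0; nra.
have [psi [psi_near psi_def]] :=
  correct_defect (map_eps n) e0 C0 eC2 betaC' beta_d.
exists psi; split=> [x|x y].
  apply: le_trans (psi_near x) _; rewrite ler_pM2r //.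
apply: le_trans (psi_def x y) _.
rewrite -/(eps n); move: epsn; rewrite /Q.
move: (eps n) (C) e0 => r p r0 rp.
rewrite (_ : _ + _ = r * (8^-1 + (6 * p ^+ 2 + 4 * p + 3) * r)); last by field.
rewrite ler_pM2l //; lra.
Qed.

End DefectDiminishing.

(** * Limits of geometrically convergent sequences *)

Section GeometricLimits.
Variable R : realType.
Implicit Types (C x y : R).

Lemma le_geometric x y C : (forall k, x <= y + C * 2^-1 ^+ k) -> x <= y.
Proof.
move=> xC; rewrite leNgt; apply/negP => yx.
pose K := Num.bound (C / (x - y)).
have d0 : 0 < x - y by rewrite subr_gt0.
have := xC K; rewrite -lerBlDl leNgt => /negP; apply.
rewrite exprVn ltr_pdivrMr ?exprn_gt0 // mulrC -ltr_pdivrMr //.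
have [C0|C0] := leP 0 C.
  have := archi_boundP (divr_ge0 C0 (ltW d0)); move/lt_trans; apply.
  by rewrite -natrX ltr_nat ltn_expl.
by apply: (@lt_trans _ _ 0); rewrite ?exprn_gt0 // pmulr_llt0 ?invr_gt0.
Qed.

(** The intervals [[u k - 2 C / 2^k, u k + 2 C / 2^k]] are nested; the limit is the
supremum of their left ends. *)
Lemma geometric_cauchy_cvg (u : nat -> R) C :
  (forall k, `|u k.+1 - u k| <= C * 2^-1 ^+ k) ->
  exists l, forall k, `|u k - l| <= 2 * C * 2^-1 ^+ k.
Proof.
move=> uC; pose a k := u k - 2 * C * 2^-1 ^+ k.
pose b k := u k + 2 * C * 2^-1 ^+ k.
have C0 : 0 <= C.
  by have := le_trans (normr_ge0 _) (uC 0%N); rewrite expr0 mulr1.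
have aS k : a k <= a k.+1.
  have := uC k; rewrite /a exprS; move: (_ ^+ _) => t; rewrite ler_norml; lra.
have bS k : b k.+1 <= b k.
  have := uC k; rewrite /b exprS; move: (_ ^+ _) => t; rewrite ler_norml; lra.
have ab k : a k <= b k.
  have : 0 <= C * 2^-1 ^+ k by rewrite mulr_ge0 // exprn_ge0 // invr_ge0.
  by rewrite /a /b; move: (_ ^+ _) => t; lra.
have aP m n : (m <= n)%N -> a m <= a n.
  move=> /subnKC <-; elim: (n - m)%N => [|k IHk]; first by rewrite addn0.
  by rewrite addnS; exact: le_trans IHk (aS _).
have bP m n : (m <= n)%N -> b n <= b m.
  move=> /subnKC <-; elim: (n - m)%N => [|k IHk]; first by rewrite addn0.
  by rewrite addnS; exact: le_trans (bS _) IHk.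
have abP m n : a m <= b n.
  apply: le_trans (aP m (maxn m n) (leq_maxl _ _)) _.
  exact: le_trans (ab _) (bP n _ (leq_maxr _ _)).
exists (sup (range a)) => k.
have lb : a k <= sup (range a).
  by apply: ub_le_sup; [exists (b 0%N) => _ [m _ <-] | exists k].
have ub : sup (range a) <= b k.
  by apply: ge_sup; [exists (a k), k | move=> _ [m _ <-]].
by move: lb ub; rewrite /a /b ler_norml; move: (_ ^+ _) => t; lra.
Qed.

Lemma Re_norm_le (z : R[i]) :
  complex.Re `|z| <= `|complex.Re z| + `|complex.Im z|.
Proof.
rewrite normc_def /= -[leRHS]ger0_norm ?addr_ge0 // -sqrtr_sqr ler_wsqrtr //.
rewrite sqrrD !real_normK ?num_real // -addrA lerD2l lerDr.
by rewrite mulrn_wge0 // mulr_ge0.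
Qed.

Lemma norm_Re_le (z : R[i]) : `|complex.Re z| <= complex.Re `|z|.
Proof.
by rewrite normc_def /= -sqrtr_sqr ler_wsqrtr // lerDl sqr_ge0.
Qed.

Lemma norm_Im_le (z : R[i]) : `|complex.Im z| <= complex.Re `|z|.
Proof.
by rewrite normc_def /= -sqrtr_sqr ler_wsqrtr // lerDr sqr_ge0.
Qed.

End GeometricLimits.

Section MatrixLimits.
Variables (R : realType) (n : nat) (N : unitary_norm R n).
Implicit Types A B : 'M[R[i]]_n.

(** [E_ii A E_jj = A_ij E_ij], so submultiplicativity bounds [A_ij] by a constant,
depending on the norm, times [N A]. *)
Lemma unorm_entry_le :
  exists2 c, 0 <= c & forall A i j, complex.Re `|A i j| <= c * N A.
Proof.
pose D (p : 'I_n * 'I_n) := delta_mx p.1 p.2 : 'M[R[i]]_n.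
pose c p := N (D (p.1, p.1)) * N (D (p.2, p.2)) / N (D p).
have c0 p : 0 <= c p by rewrite divr_ge0 ?mulr_ge0 ?unorm_ge0.
exists (\sum_p c p) => [|A i j]; first exact: sumr_ge0.
apply: (@le_trans _ _ (c (i, j) * N A)); last first.
  rewrite ler_wpM2r ?unorm_ge0 // (bigD1 (i, j)) //= lerDl.
  by apply: sumr_ge0.
have Dij : 0 < N (D (i, j)).
  rewrite lt_neqAle unorm_ge0 andbT eq_sym; apply/eqP => /unorm0_eq0.
  by move=> /matrixP/(_ i j)/eqP; rewrite !mxE !eqxx oner_eq0.
rewrite /c mulrAC ler_pdivlMr //= -unormZ mulrAC.
have -> : A i j *: D (i, j) = D (i, i) *m A *m D (j, j).
  apply/matrixP => k l; rewrite !mxE (bigD1 j) //= big1 => [|m mj].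
    rewrite addr0 !mxE (bigD1 i) //= big1 => [|m mi].
      rewrite addr0 !mxE !eqxx andbT.
      by case: (k == i); case: (l == j); rewrite ?(mulr1, mulr0, mul1r, mul0r).
    by rewrite !mxE [m == i]negbTE // andbF mul0r.
  by rewrite !mxE [m == j]negbTE // mulr0.
by apply: le_trans (unormM _ _ _) _; rewrite ler_wpM2r ?unorm_ge0 // unormM.
Qed.

Lemma unorm_le_entry : exists2 c, 0 <= c &
  forall A r, (forall i j, complex.Re `|A i j| <= r) -> N A <= c * r.
Proof.
exists (\sum_i \sum_j N (delta_mx i j)) => [|A r Ar].
  by apply: sumr_ge0 => i _; apply: sumr_ge0 => j _; exact: unorm_ge0.
have sumN (I : finType) (F : I -> 'M[R[i]]_n) :
    N (\sum_i F i) <= \sum_i N (F i).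
  elim/big_ind2: _ => [|a b c d ab cd|//]; first by rewrite unorm0.
  exact: le_trans (unormD _ _ _) (lerD ab cd).
rewrite [in leLHS](matrix_sum_delta A) mulr_suml.
apply: le_trans (sumN _ _) (ler_sum _ _) => i _; rewrite mulr_suml.
apply: le_trans (sumN _ _) (ler_sum _ _) => j _.
by rewrite unormZ mulrC ler_wpM2l ?unorm_ge0.
Qed.

(** Continuity of the adjoint, for showing that limits of unitary matrices are
unitary; it follows from the entrywise estimates without singular values. *)
Lemma unorm_adjoint_le : exists2 c, 0 <= c & forall A, N (A^t*) <= c * N A.
Proof.
have [c c0 cP] := unorm_entry_le; have [d d0 dP] := unorm_le_entry.
exists (d * c) => [|A]; first exact: mulr_ge0.
rewrite -mulrA; apply: dP => i j; rewrite !mxE.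
by rewrite [`|_|](_ : _ = `|A j i|) ?cP // norm_conjC.
Qed.

Lemma unorm_cvg (A : nat -> 'M[R[i]]_n) C :
  (forall k, N (A k.+1 - A k) <= C * 2^-1 ^+ k) ->
  exists L K, forall k, N (A k - L) <= K * 2^-1 ^+ k.
Proof.
move=> AC; have [c c0 cP] := unorm_entry_le; have [d d0 dP] := unorm_le_entry.
have entC i j k : complex.Re `|A k.+1 i j - A k i j| <= c * C * 2^-1 ^+ k.
  have := cP (A k.+1 - A k) i j; rewrite !mxE => /le_trans; apply.
  by rewrite -mulrA ler_wpM2l.
have /choice[re reP] : forall p : 'I_n * 'I_n, exists l, forall k,
    `|complex.Re (A k p.1 p.2) - l| <= 2 * (c * C) * 2^-1 ^+ k.
  move=> p; apply: geometric_cauchy_cvg => k; rewrite -raddfB.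
  exact: le_trans (norm_Re_le _) (entC _ _ _).
have /choice[im imP] : forall p : 'I_n * 'I_n, exists l, forall k,
    `|complex.Im (A k p.1 p.2) - l| <= 2 * (c * C) * 2^-1 ^+ k.
  move=> p; apply: geometric_cauchy_cvg => k; rewrite -raddfB.
  exact: le_trans (norm_Im_le _) (entC _ _ _).
exists (\matrix_(i, j) (re (i, j) +i* im (i, j))%C).
exists (d * (2 * (c * C) + 2 * (c * C))) => k.
rewrite -mulrA; apply: dP => i j; rewrite !mxE.
apply: le_trans (Re_norm_le _) _; rewrite !raddfB mulrDl.
exact: lerD (reP (i, j) k) (imP (i, j) k).
Qed.

End MatrixLimits.

(** * Iterating the correction *)

Section LimitHomomorphism.
Variables (R : realType) (n : nat) (N : unitary_norm R n).

Lemma unorm_geometric_eq0 (A : 'M[R[i]]_n) C :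
  (forall k, N A <= C * 2^-1 ^+ k) -> A = 0.
Proof.
move=> AC; apply: (@unorm0_eq0 _ _ N); apply/eqP.
rewrite eq_le unorm_ge0 andbT; apply: (@le_geometric _ _ _ C) => k.
by rewrite add0r.
Qed.

Lemma unitary_cvg (u : nat -> unitary R n) C :
  (forall k, N (unitary_mx (u k.+1) - unitary_mx (u k)) <= C * 2^-1 ^+ k) ->
  exists (w : unitary R n) K,
    forall k, N (unitary_mx (u k) - unitary_mx w) <= K * 2^-1 ^+ k.
Proof.
move=> /unorm_cvg[L [K uL]]; have [c c0 cP] := unorm_adjoint_le N.
suff LU : L \is unitarymx by exists (Unitary LU), K.
apply/unitarymxP/eqP; rewrite eq_sym -subr_eq0; apply/eqP.
apply: (@unorm_geometric_eq0 _ (K + N L * (c * K))) => k.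
have <- : (unitary_mx (u k) - L) *m (u k)^-1%g +
    L *m (unitary_mx (u k) - L)^t* = 1%:M - L *m L^t*.
  rewrite mulmxBl unitarymxC [in (_ - L)^T]linearB map_mxB mulmxBr /=.
  by rewrite addrA subrK.
rewrite mulrDl; apply: unormD_le; first by rewrite unorm_mulur.
rewrite -!mulrA; apply: le_trans (unormM _ _ _) _.
by rewrite ler_wpM2l ?unorm_ge0 //; apply: le_trans (cP _) _; rewrite ler_wpM2l.
Qed.

Lemma limit_hom (Gamma : groupType) (u : nat -> Gamma -> unitary R n)
    (w : Gamma -> unitary R n) (e : R) :
  (forall x, exists K, forall k,
    N (unitary_mx (u k x) - unitary_mx (w x)) <= K * 2^-1 ^+ k) ->
  (forall k x y, N (unitary_mx (u k (x * y)%g) - unitary_mx (u k x * u k y)%g)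
    <= e * 2^-1 ^+ k) ->
  {morph w : x y / (x * y)%g}.
Proof.
move=> uw ue x y; have [Kx xP] := uw x; have [Ky yP] := uw y.
have [Kxy xyP] := uw (x * y)%g; apply/val_inj/eqP; rewrite -subr_eq0; apply/eqP.
apply: (@unorm_geometric_eq0 _ (Kxy + e + Ky + Kx)) => k.
rewrite !mulrDl; apply: le_trans (unorm_dist_trans N (u k x * w y)%g _ _) _.
apply: lerD; last by rewrite unitary_dist_mulr.
apply: le_trans (unorm_dist_trans N (u k x * u k y)%g _ _) _.
apply: lerD; last by rewrite unitary_dist_mull.
apply: le_trans (unorm_dist_trans N (u k (x * y)%g) _ _) _.
by apply: lerD; rewrite // unorm_distC.
Qed.

End LimitHomomorphism.

Section Stability.
Variables (R : realType) (Gamma : groupType).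

(** Makes the suprema defining the defect and the homomorphism distance genuine. *)
Lemma udist_le (G : ufamily R) (u v : unitary R (udim G)) :
  udist u v <= unrm G 1%:M + unrm G 1%:M.
Proof.
have N1 w : unrm G (unitary_mx w) = unrm G 1%:M.
  by rewrite -[unitary_mx w]mulmx1 unorm_mulul.
by apply: unormB_le; rewrite N1.
Qed.

Lemma defect_almost_mult (G : ufamily R) (phi : Gamma -> unitary R (udim G)) e :
  defect phi <= e -> almost_mult phi e.
Proof.
move=> de x y; apply: le_trans de; apply: ub_le_sup; last by exists (x, y).
by exists (unrm G 1%:M + unrm G 1%:M) => _ [p _ <-]; exact: udist_le.
Qed.

Lemma hom_dist_le (G : ufamily R) (phi psi : Gamma -> unitary R (udim G)) r :
  {morph psi : x y / (x * y)%g} ->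
  (forall x, udist (phi x) (psi x) <= r) -> hom_dist phi <= r.
Proof.
move=> psiM phipsi.
pose h : {multiplicative Gamma -> unitary R (udim G)} :=
  HB.pack psi (isMultiplicative.Build _ _ psi psiM).
apply: (@le_trans _ _ (sup (range (fun x => udist (phi x) (h x))))).
  apply: ge_inf; last by exists h.
  exists 0 => _ [f _ <-]; apply: le_trans (unorm_ge0 (unrm G) _) (ub_le_sup _ _).
    by exists (unrm G 1%:M + unrm G 1%:M) => _ [p _ <-]; exact: udist_le.
  by exists 1%g.
apply: ge_sup; last by move=> _ [x _ <-]; exact: phipsi.
by eexists; exists 1%g.
Qed.

(** The [k]-th iterate has defect at most [eps / 2^k] and lies within
[K * eps / 2^k] of the next one, so the limit is a homomorphism within
[2 * K * eps] of [phi]. *)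
Lemma diminishing_stable (e1 K : R) :
  0 < e1 -> 0 <= K ->
  (forall e, 0 <= e -> e <= e1 ->
    forall (G : ufamily R) (phi : Gamma -> unitary R (udim G)),
      almost_mult phi e -> improvable phi e K) ->
  uniformly_stable_linear R Gamma.
Proof.
move=> e1_gt0 K0 improve; exists e1, (2 * K); split=> //; first exact: mulr_ge0.
move=> eps eps_lt G phi /defect_almost_mult phi_eps.
have eps0 : 0 <= eps.
  by have /andP[/le_trans] := almost_mult_defect phi_eps; apply.
(* The step is made a total function so that it can be iterated; outside its
   range of validity its value is arbitrary. *)
have /choice[step stepP] : forall p : (Gamma -> unitary R (udim G)) * R,
    exists psi : Gamma -> unitary R (udim G), 0 <= p.2 <= e1 ->
      almost_mult p.1 p.2 ->
      (forall x, unrm G (unitary_mx (p.1 x) - unitary_mx (psi x)) <= K * p.2) /\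
      almost_mult psi (p.2 / 2).
  move=> [f e] /=; have [H|nH] := pselect (0 <= e <= e1 /\ almost_mult f e).
    case: H => /andP[e0 ee1] fe; have [psi psiP] := improve e e0 ee1 G f fe.
    by exists psi.
  by exists f => e0 fe; case: nH.
pose fix u k := if k is j.+1 then step (u j, eps * 2^-1 ^+ j) else phi.
have ek k : 0 <= eps * 2^-1 ^+ k <= e1.
  have p0 : 0 <= 2^-1 ^+ k :> R by rewrite exprn_ge0 // invr_ge0.
  rewrite mulr_ge0 //=; apply: le_trans (ltW eps_lt).
  by rewrite ler_piMr // exprn_ile1 ?invr_ge0 // invf_le1 // ler1n.
have ue k : almost_mult (u k) (eps * 2^-1 ^+ k).
  elim: k => [|k IHk]; first by rewrite expr0 mulr1.
  have [_] := stepP (u k, eps * 2^-1 ^+ k) (ek k) IHk.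
  by rewrite /= -mulrA -exprSr.
have uS k x : unrm G (unitary_mx (u k x) - unitary_mx (u k.+1 x)) <=
    K * eps * 2^-1 ^+ k.
  have [H _] := stepP (u k, eps * 2^-1 ^+ k) (ek k) (ue k).
  by rewrite -mulrA; exact: H.
have /choice[w wP] : forall x, exists (w : unitary R (udim G)), exists C,
    forall k, unrm G (unitary_mx (u k x) - unitary_mx w) <= C * 2^-1 ^+ k.
  move=> x; apply: (@unitary_cvg _ _ _ _ (K * eps)) => k.
  by rewrite unorm_distC.
have wM := limit_hom wP ue.
apply: (hom_dist_le wM) => x.
have [C uw] := wP x; apply: (@le_geometric _ _ _ C) => k.
apply: le_trans (unorm_dist_trans _ (unitary_mx (u k x)) _ _) _.
apply: lerD (uw k).
have : unrm G (unitary_mx (phi x) - unitary_mx (u k x)) <=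
    2 * K * eps * (1 - 2^-1 ^+ k).
  elim: k => [|k IHk]; first by rewrite subrr unorm0 expr0 subrr mulr0.
  apply: le_trans (unorm_dist_trans _ (unitary_mx (u k x)) _ _) _.
  apply: le_trans (lerD IHk (uS k x)) _; rewrite exprS.
  by rewrite le_eqVlt; apply/orP; left; apply/eqP; field.
move/le_trans; apply; rewrite ler_piMr ?mulr_ge0 // gerBl.
by rewrite exprn_ge0 // invr_ge0.
Qed.

End Stability.

Theorem theorem0p0p3 (R : realType) (U : free_ultrafilter) (Gamma : groupType)
    (countable_Gamma : countable [set: Gamma])
    (H2_zero : forall (phi : asym_hom R Gamma U) (c : asym_cohomology phi 2),
       c = 0) :
  uniformly_stable_linear R Gamma.
Proof.
have [e1 [K [e1_gt0 K_ge0 improve]]] := defect_diminishing H2_zero.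
exact: diminishing_stable e1_gt0 K_ge0 improve.
Qed.
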